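(* Let $R$ be a commutative noetherian ring, let $C$ be a semidualizing $R$-module, and let $M$ and $N$ be $R$-modules. If $M\in\mathcal{B}_C(R)$ and $N\in\mathcal{A}_C(R)$, then for each $i$ there are isomorphisms $$\operatorname{Tor}^{\mathcal{P}_C\mathcal{M}}_i(M,N)\cong\operatorname{Tor}^R_i(M,N),\qquad \operatorname{Tor}^{\mathcal{F}_C\mathcal{M}}_i(M,N)\cong\operatorname{Tor}^R_i(M,N).$$
   Context: $R$ is a commutative noetherian ring. A finitely generated $R$-module $C$ is semidualizing if the homothety map $R\to\operatorname{Hom}_R(C,C)$ is an isomorphism and $\operatorname{Ext}^i_R(C,C)=0$ for all $i\geq 1$. $\mathcal{P}_C(R)$ is the class of $R$-modules isomorphic to $P\otimes_R C$ with $P$ projective, and $\mathcal{F}_C(R)$ is the class of $R$-modules isomorphic to $F\otimes_R C$ with $F$ flat; both are precovering. For a precovering class $\mathcal{X}$, a proper $\mathcal{X}$-resolution of $M$ is a complex $X=(\cdots\to X_1\to X_0\to 0)$ with each $X_i\in\mathcal{X}$ together with an augmentation $X_0\to M$ such that $X^+=(\cdots\to X_1\to X_0\to M\to 0)$ is a complex (not necessarily exact) and $\operatorname{Hom}_R(Y,X^+)$ is exact for all $Y\in\mathcal{X}$. If $Q$ is a proper $\mathcal{P}_C$-resolution of $M$ and $G$ is a proper $\mathcal{F}_C$-resolution of $M$, then for $i\geq 0$ $$\operatorname{Tor}^{\mathcal{P}_C\mathcal{M}}_i(M,N):=H_i(Q\otimes_R N),\qquad \operatorname{Tor}^{\mathcal{F}_C\mathcal{M}}_i(M,N):=H_i(G\otimes_R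 N),$$ independent of the choice of proper resolutions. The Auslander class $\mathcal{A}_C(R)$ is the class of $R$-modules $M$ such that $\operatorname{Tor}^R_i(C,M)=0=\operatorname{Ext}^i_R(C,C\otimes_R M)$ for all $i\geq 1$ and the natural map $M\to\operatorname{Hom}_R(C,C\otimes_R M)$ is an isomorphism. The Bass class $\mathcal{B}_C(R)$ is the class of $R$-modules $M$ such that $\operatorname{Ext}^i_R(C,M)=0=\operatorname{Tor}^R_i(C,\operatorname{Hom}_R(C,M))$ for all $i\geq 1$ and the natural evaluation map $C\otimes_R\operatorname{Hom}_R(C,M)\to M$ is an isomorphism. *)

(* Defs.v *)
From HB Require Import structures.
From mathcomp Require Import all_boot all_order all_algebra.
From mathcomp Require Import generic_quotient ring_quotient.
From mathcomp Require Import boolp classical_sets functions cardinality fsbigop.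

Set Implicit Arguments.
Unset Strict Implicit.
Unset Printing Implicit Defensive.

Import GRing.Theory.
Local Open Scope ring_scope.

Notation submodClosed := GRing.SubmodClosed.type.

(* Hom_R(M, N) is the type {linear M -> N} itself, made into an R-module as a
   submodule of the module of all functions M -> N. *)
Section Hom.
Variables (R : comPzRingType) (M N : lmodType R).

Definition to_linear (f : M -> N) (hf : linear f) : {linear M -> N} :=
  HB.pack f (GRing.isLinear.Build R M N *:%R f hf).

Definition is_linear : {pred (M -> N)} := fun f => `[< linear f >].

Lemma is_linear_closed : GRing.subsemimod_closed is_linear.
Proof.
split; first split.
- by apply/asboolP => a x y; rewrite /= scaler0 addr0.
- move=> f g /asboolP hf /asboolP hg; apply/asboolP => a x y /=.
  by rewrite !fctE hf hg scalerDr addrACA.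
- move=> a f /asboolP hf; apply/asboolP => b x y /=.
  by rewrite !fctE hf scalerDr !scalerA mulrC.
Qed.

HB.instance Definition _ := GRing.isSubmodClosed.Build R (M -> N) is_linear is_linear_closed.

Definition linear_of (f : M -> N) (hf : f \in is_linear) : {linear M -> N} :=
  to_linear (asboolW hf).

Lemma linear_ext (f g : {linear M -> N}) : f =1 g -> f = g.
Proof.
move=> /funext; case: f g => f [[f1] [f2]] [g [[g1] [g2]]] /= fg.
by subst g; rewrite (Prop_irrelevance f1 g1) (Prop_irrelevance f2 g2).
Qed.

Lemma linear_is_linear (f : {linear M -> N}) : (f : M -> N) \in is_linear.
Proof. by apply/asboolP => a x y; rewrite linearP. Qed.

Lemma linear_rect (K : {linear M -> N} -> Type) :
  (forall f hf, K (@linear_of f hf)) -> forall u, K u.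
Proof.
move=> h u; have -> : u = linear_of (linear_is_linear u) by exact: linear_ext.
exact: h.
Qed.

HB.instance Definition _ := @isSub.Build (M -> N) is_linear {linear M -> N}
  (fun f : {linear M -> N} => (f : M -> N)) linear_of linear_rect
  (fun f hf => erefl).
HB.instance Definition _ := [Choice of {linear M -> N} by <:].
HB.instance Definition _ :=
  [SubChoice_isSubLmodule of {linear M -> N} by <:].

Lemma linear_addE (f g : {linear M -> N}) x : (f + g) x = f x + g x.
Proof. by []. Qed.

Lemma linear_scaleE a (f : {linear M -> N}) x : (a *: f) x = a *: f x.
Proof. by []. Qed.

End Hom.

Section SubQuotient.
Variables (R : comPzRingType) (M : lmodType R).

Record submod (S : submodClosed M) :=
  Submod { submod_val :> M; _ : submod_val \in S }.

HB.instance Definition _ (S : submodClosed M) := [isSub for @submod_val S].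
HB.instance Definition _ (S : submodClosed M) := [Choice of submod S by <:].
HB.instance Definition _ (S : submodClosed M) :=
  [SubChoice_isSubLmodule of submod S by <:].

Definition submod_incl (S : submodClosed M) : {linear submod S -> M} := val.

Variable S : submodClosed M.

Fact submod_zmod_closed : zmod_closed S.
Proof.
by split=> [|x y Sx Sy]; [exact: rpred0 | rewrite -scaleN1r rpredD ?rpredZ].
Qed.

Definition zmod_of_submod : zmodClosed M :=
  HB.pack (GRing.SubmodClosed.sort S)
    (GRing.isZmodClosed.Build M (GRing.SubmodClosed.sort S) submod_zmod_closed).

Definition quotmod := Quotient.quot zmod_of_submod.
HB.instance Definition _ := Quotient.on quotmod.
HB.instance Definition _ := GRing.Zmodule.on quotmod.

Lemma quot_eqE x y : (\pi_(quotmod) x == \pi_(quotmod) y)%qT = (x - y \in S).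
Proof. by have <- := Quotient.idealrBE zmod_of_submod x y. Qed.

Definition quot_scale (a : R) : quotmod -> quotmod := lift_op1 quotmod ( *:%R a).

Lemma pi_scale a : {morph \pi_(quotmod) : x / a *: x >-> quot_scale a x}%qT.
Proof.
move=> x; unlock quot_scale; apply/eqP.
by rewrite quot_eqE -scalerBr rpredZ // -quot_eqE reprK.
Qed.

Fact quot_scalerA a b x : quot_scale a (quot_scale b x) = quot_scale (a * b) x.
Proof. by rewrite -[x]reprK -!pi_scale scalerA. Qed.

Fact quot_scale1r : left_id 1 quot_scale.
Proof. by move=> x; rewrite -[x]reprK -!pi_scale scale1r. Qed.

Fact quot_scalerDr : right_distributive quot_scale +%R.
Proof.
by move=> a x y; rewrite -[x]reprK -[y]reprK -!pi_scale -!raddfD /= -pi_scale scalerDr.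
Qed.

Fact quot_scalerDl x : {morph quot_scale^~ x : a b / a + b}.
Proof. by move=> a b /=; rewrite -[x]reprK -!pi_scale -raddfD /= -scalerDl. Qed.

HB.instance Definition _ := GRing.Zmodule_isLmodule.Build R quotmod
  quot_scalerA quot_scale1r quot_scalerDr quot_scalerDl.

Lemma pi_is_linear : linear (\pi_(quotmod)%qT : M -> quotmod).
Proof. by move=> a x y; rewrite raddfD /= pi_scale. Qed.

Definition quot_pi : {linear M -> quotmod} :=
  to_linear pi_is_linear.

Lemma quot_pi_surj q : exists x, q = quot_pi x.
Proof. by exists (repr q); rewrite /= reprK. Qed.

Definition quot_lift_fun (N : lmodType R) (f : M -> N) : quotmod -> N :=
  fun q => f (repr q).

Lemma quot_lift_pi (N : lmodType R) (f : {linear M -> N}) :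
  {in S, forall x, f x = 0} -> forall x, quot_lift_fun f (quot_pi x) = f x.
Proof.
move=> fS x; apply/eqP; rewrite -subr_eq0 -linearB /= fS //.
by rewrite -quot_eqE reprK.
Qed.

Lemma quot_lift_linear (N : lmodType R) (f : {linear M -> N}) :
  {in S, forall x, f x = 0} -> linear (quot_lift_fun f).
Proof.
move=> fS a x y; have [u ->] := quot_pi_surj x; have [v ->] := quot_pi_surj y.
by rewrite -linearP !quot_lift_pi // linearP.
Qed.

Definition quot_lift (N : lmodType R) (f : {linear M -> N})
    (fS : {in S, forall x, f x = 0}) : {linear quotmod -> N} :=
  to_linear (quot_lift_linear fS).

End SubQuotient.

Section KernelImage.
Variables (R : comPzRingType) (M N : lmodType R) (f : {linear M -> N}).

Definition kernel_submod : {pred M} := fun x => f x == 0.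

Lemma mem_kernel x : (x \in kernel_submod) = (f x == 0). Proof. by []. Qed.

Lemma kernel_closed : GRing.subsemimod_closed kernel_submod.
Proof.
split; first split.
- by rewrite mem_kernel linear0.
- by move=> x y; rewrite !mem_kernel linearD => /eqP-> /eqP->; rewrite addr0.
- by move=> a x; rewrite !mem_kernel linearZ /= => /eqP->; rewrite scaler0.
Qed.
HB.instance Definition _ := GRing.isSubmodClosed.Build R M kernel_submod kernel_closed.

Definition image_submod : {pred N} := fun y => `[< exists x, f x = y >].

Lemma image_closed : GRing.subsemimod_closed image_submod.
Proof.
split; first split.
- by apply/asboolP; exists 0; rewrite linear0.
- move=> _ _ /asboolP[x <-] /asboolP[y <-].
  by apply/asboolP; exists (x + y); rewrite linearD.
- by move=> a _ /asboolP[x <-]; apply/asboolP; exists (a *: x); rewrite linearZ.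
Qed.
HB.instance Definition _ := GRing.isSubmodClosed.Build R N image_submod image_closed.

Definition preim_submod (S : submodClosed N) : {pred M} := fun x => f x \in S.

Lemma mem_preimage S x : (x \in preim_submod S) = (f x \in S).
Proof. by []. Qed.

Lemma preimage_closed S : GRing.subsemimod_closed (preim_submod S).
Proof.
split; first split.
- by rewrite mem_preimage linear0 rpred0.
- by move=> x y; rewrite !mem_preimage linearD; exact: rpredD.
- by move=> a x; rewrite !mem_preimage linearZ; exact: rpredZ.
Qed.
HB.instance Definition _ S :=
  GRing.isSubmodClosed.Build R M (preim_submod S) (preimage_closed S).

End KernelImage.

Definition span_submod (R : comPzRingType) (M : lmodType R) (A : set M) : {pred M} :=
  fun x => `[< forall S : submodClosed M, (forall y, A y -> y \in S) -> x \in S >].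

Section Span.
Variables (R : comPzRingType) (M : lmodType R) (A : set M).
Lemma span_closed : GRing.subsemimod_closed (span_submod A).
Proof.
split; first split.
- by apply/asboolP => S _; exact: rpred0.
- move=> x y /asboolP Ax /asboolP Ay; apply/asboolP => S AS.
  by apply: rpredD; [exact: Ax | exact: Ay].
- by move=> a x /asboolP Ax; apply/asboolP => S AS; apply: rpredZ; exact: Ax.
Qed.
HB.instance Definition _ := GRing.isSubmodClosed.Build R M (span_submod A) span_closed.
End Span.

Section FreeModule.
Variables (R : comPzRingType) (X : choiceType).
Local Open Scope classical_set_scope.

Definition finite_support : {pred (X -> R^o)} :=
  fun f => `[< finite_set [set x | f x != 0] >].

Lemma finsupp_closed : GRing.subsemimod_closed finite_support.
Proof.
split; first split.
- apply/asboolP; rewrite (_ : [set _ | _] = set0) //.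
  by rewrite predeqE => x; split=> // /eqP[].
- move=> f g /asboolP ff /asboolP fg; apply/asboolP.
  apply: (@sub_finite_set _ _ ([set x | f x != 0] `|` [set x | g x != 0])).
    move=> x /=; case: (eqVneq (f x) 0) => [fx|]; last by left.
    by rewrite fctE fx add0r; right.
  by rewrite finite_setU.
- move=> a f /asboolP ff; apply/asboolP; apply: sub_finite_set ff => x /=.
  by apply: contra_neq => fx; rewrite fctE fx scaler0.
Qed.
HB.instance Definition _ :=
  GRing.isSubmodClosed.Build R (X -> R^o) finite_support finsupp_closed.

Definition free_mod : lmodType R := submod finite_support.

Definition free_coef (f : free_mod) : X -> R := submod_val f.

Lemma free_coef_finite (f : free_mod) : finite_set [set x | free_coef f x != 0].
Proof. by case: f => f /= /asboolP. Qed.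

Fact free_base_subproof (x : X) : (fun y => (y == x)%:R : R^o) \in finite_support.
Proof.
apply/asboolP; apply: (@sub_finite_set _ _ [set x]); last exact: finite_set1.
by move=> y /=; case: (eqVneq y x) => //= _; rewrite eqxx.
Qed.

Definition free_base (x : X) : free_mod := Submod (free_base_subproof x).

Variable M : lmodType R.

Definition free_lift_fun (h : X -> M) (f : free_mod) : M :=
  \sum_(x \in [set: X]) free_coef f x *: h x.

Lemma free_lift_seq (h : X -> M) (f : free_mod) (s : seq X) : uniq s ->
  (forall x, free_coef f x != 0 -> x \in s) ->
  free_lift_fun h f = \sum_(x <- s) free_coef f x *: h x.
Proof.
move=> us fs; rewrite /free_lift_fun -(fsbig_widen [set` s] [set: X]) //=.
  by rewrite -fsbig_seq.
move=> x [_ /= xs]; case: (eqVneq (free_coef f x) 0) => [->|/fs //].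
by rewrite scale0r.
Qed.

Lemma free_lift_linear (h : X -> M) : linear (free_lift_fun h).
Proof.
move=> a f g.
have [s us sP] : exists2 s : seq X, uniq s & forall x,
    (free_coef f x != 0) || (free_coef g x != 0) -> x \in s.
  have /finite_seqP[s sE] : finite_set ([set x | free_coef f x != 0] `|`
      [set x | free_coef g x != 0]).
    by rewrite finite_setU; split; exact: free_coef_finite.
  exists (undup s) => [|x /orP fgx]; first exact: undup_uniq.
  by rewrite mem_undup; have : [set` s] x by rewrite -sE.
have e x : free_coef (a *: f + g) x = a * free_coef f x + free_coef g x by [].
rewrite !(free_lift_seq h us) => [|x gx|x fx|x].
- rewrite scaler_sumr -big_split /=; apply: eq_bigr => x _.
  by rewrite scalerA -scalerDl; congr (_ *: _).
- by apply: sP; rewrite gx orbT.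
- by apply: sP; rewrite fx.
- rewrite [free_coef _ x](e x); apply: contraR => /(contra (sP x)).
  by rewrite negb_or !negbK => /andP[/eqP-> /eqP->]; rewrite mulr0 addr0.
Qed.

Definition free_lift (h : X -> M) : {linear free_mod -> M} :=
  to_linear (free_lift_linear h).

Lemma free_lift_base (h : X -> M) x : free_lift h (free_base x) = h x.
Proof.
rewrite /= (@free_lift_seq _ _ [:: x]) // => [|y].
  by rewrite big_seq1 /= eqxx scale1r.
by rewrite /= inE; case: (eqVneq y x) => //= _; rewrite eqxx.
Qed.

End FreeModule.

Lemma free_ext (R : comPzRingType) (X : choiceType) (M : lmodType R)
    (f g : {linear free_mod R X -> M}) :
  (forall x, f (free_base R x) = g (free_base R x)) -> f =1 g.
Proof.
move=> fg u.
have /finite_seqP[s sE] := free_coef_finite u.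
pose t := undup s.
have uE : u = \sum_(x <- t) free_coef u x *: free_base R x.
  apply: val_inj; apply: funext => y; rewrite raddf_sum fct_sumE /=.
  have tE x : (x \in t) = (free_coef u x != 0).
    have e : (free_coef u x != 0 : Prop) = (x \in s : Prop).
      exact: (congr1 (fun A : set X => A x) sE).
    by rewrite mem_undup; apply/idP/idP => h; [rewrite e | rewrite -e].
  have [yt|yt] := boolP (y \in t).
    rewrite (bigD1_seq y) ?undup_uniq //= big1 => [|x xy].
      by rewrite addr0 /= !fctE /= eqxx; symmetry; exact: mulr1.
    by rewrite !fctE /= eq_sym (negPf xy); exact: mulr0.
  rewrite big_seq big1 => [|x xt].
    by move: yt; rewrite tE negbK => /eqP.
  have /negPf yx : y != x by apply: contraNneq yt => ->.
  by rewrite !fctE /= yx; exact: mulr0.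
rewrite uE !raddf_sum; apply: eq_bigr => x _.
have E (h : {linear free_mod R X -> M}) : h (free_coef u x *: free_base R x) =
    free_coef u x *: h (free_base R x) by exact: linearZ.
by apply: etrans (E f) (etrans _ (esym (E g))); rewrite fg.
Qed.

Lemma span_sub (R : comPzRingType) (M N : lmodType R) (A : set M)
    (f : {linear M -> N}) :
  (forall x, A x -> f x = 0) -> {in span_submod A, forall x, f x = 0}.
Proof.
move=> fA x /asboolP /(_ (kernel_submod f)) Sx; apply/eqP; rewrite -mem_kernel.
by apply: Sx => y /fA/eqP; rewrite mem_kernel.
Qed.

Section Tensor.
Variables (R : comPzRingType) (M N : lmodType R).
Local Notation e x y := (free_base R (x, y)).

Inductive tensor_rel : set (free_mod R (M * N)%type) :=
| tensor_relDl x x' y : tensor_rel (e (x + x') y - e x y - e x' y)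
| tensor_relDr x y y' : tensor_rel (e x (y + y') - e x y - e x y')
| tensor_relZl a x y : tensor_rel (e (a *: x) y - a *: e x y)
| tensor_relZr a x y : tensor_rel (e x (a *: y) - a *: e x y).

Definition tensor : lmodType R := quotmod (span_submod tensor_rel).

Definition tens (x : M) (y : N) : tensor := quot_pi (span_submod tensor_rel) (e x y).

Lemma tensor_rel0 z : tensor_rel z -> quot_pi (span_submod tensor_rel) z = 0.
Proof.
move=> rz; rewrite -[RHS](linear0 (quot_pi (span_submod tensor_rel))) /=.
by apply/eqP; rewrite quot_eqE subr0; apply/asboolP => S; apply.
Qed.

Lemma tens_linearl y : linear (tens^~ y).
Proof.
move=> a x x'; apply/eqP; rewrite -subr_eq0 opprD addrA.
have /eqP := tensor_rel0 (tensor_relDl (a *: x) x' y).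
have := tensor_rel0 (tensor_relZl a x y).
by rewrite !linearB linearZ /= => /eqP; rewrite subr_eq0 => /eqP ->.
Qed.

Lemma tens_linearr x : linear (tens x).
Proof.
move=> a y y'; apply/eqP; rewrite -subr_eq0 opprD addrA.
have /eqP := tensor_rel0 (tensor_relDr x (a *: y) y').
have := tensor_rel0 (tensor_relZr a x y).
by rewrite !linearB linearZ /= => /eqP; rewrite subr_eq0 => /eqP ->.
Qed.

(* By currying, a bilinear map M x N -> P is a linear map M -> Hom_R(N, P). *)
Variable P : lmodType R.

Fact tensor_lift_subproof (b : {linear M -> {linear N -> P}}) :
  {in span_submod tensor_rel, forall z, free_lift (fun p => b p.1 p.2) z = 0}.
Proof.
pose h := fun p : M * N => b p.1 p.2; have hE x y : free_lift_fun h (e x y) = b x y.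
  exact: (free_lift_base h).
rewrite -/h; apply: span_sub => _ [x x' y|x y y'|a x y|a x y];
  rewrite !linearB ?linearZ /= !hE.
- by rewrite linearD linear_addE addrAC addrK subrr.
- by rewrite linearD addrAC addrK subrr.
- by rewrite scalerN linearZ linear_scaleE subrr.
- by rewrite scalerN linearZ subrr.
Qed.

Definition tensor_lift (b : {linear M -> {linear N -> P}}) : {linear tensor -> P} :=
  quot_lift (tensor_lift_subproof b).

Lemma tensor_liftE b x y : tensor_lift b (tens x y) = b x y.
Proof.
exact: etrans (quot_lift_pi (tensor_lift_subproof b) _) (free_lift_base _ _).
Qed.

End Tensor.

Lemma tensor_ext (R : comPzRingType) (M N P : lmodType R)
    (f g : {linear tensor M N -> P}) :
  (forall x y, f (tens x y) = g (tens x y)) -> f =1 g.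
Proof.
move=> fg z; have [u ->] := quot_pi_surj z.
apply: (@free_ext _ _ _ (f \o quot_pi _) (g \o quot_pi _)) => -[x y].
exact: fg.
Qed.

Section HomMaps.
Variables (R : comPzRingType) (M N Y : lmodType R) (f : {linear M -> N}).

Definition hom_post_fun (g : {linear Y -> M}) : {linear Y -> N} := f \o g.
Fact hom_post_linear : linear hom_post_fun.
Proof. by move=> a g h; apply: linear_ext => x; rewrite /= linearP. Qed.
Definition hom_post : {linear {linear Y -> M} -> {linear Y -> N}} :=
  to_linear hom_post_linear.

Definition hom_pre_fun (g : {linear N -> Y}) : {linear M -> Y} := g \o f.
Fact hom_pre_linear : linear hom_pre_fun.
Proof. by move=> a g h; apply: linear_ext. Qed.
Definition hom_pre : {linear {linear N -> Y} -> {linear M -> Y}} :=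
  to_linear hom_pre_linear.
End HomMaps.

Section NaturalMaps.
Variables (R : comPzRingType) (M N : lmodType R).

Definition tens_right_fun (x : M) : {linear N -> tensor M N} :=
  to_linear (tens_linearr x).
Fact tens_right_linear : linear tens_right_fun.
Proof. by move=> a x x'; apply: linear_ext => y /=; rewrite tens_linearl. Qed.
Definition tens_right : {linear M -> {linear N -> tensor M N}} :=
  to_linear tens_right_linear.

Definition tens_left_fun (y : N) : {linear M -> tensor M N} :=
  to_linear (tens_linearl y).
Fact tens_left_linear : linear tens_left_fun.
Proof. by move=> a y y'; apply: linear_ext => x /=; rewrite tens_linearr. Qed.
Definition tens_left : {linear N -> {linear M -> tensor M N}} :=
  to_linear tens_left_linear.

Definition apply_fun (x : M) : {linear {linear M -> N} -> N} :=
  @to_linear R {linear M -> N} N (fun f : {linear M -> N} => f x)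
    (fun a f g => erefl).
Fact apply_linear : linear apply_fun.
Proof. by move=> a x x'; apply: linear_ext => f /=; rewrite linearP. Qed.
Definition apply_at : {linear M -> {linear {linear M -> N} -> N}} :=
  to_linear apply_linear.

Definition evaluation : {linear tensor M {linear M -> N} -> N} :=
  tensor_lift apply_at.

Fact homothety_subproof (a : R) : linear ( *:%R a : M -> M).
Proof. by move=> b x y; rewrite scalerDr !scalerA mulrC. Qed.
Definition homothety_fun (a : R^o) : {linear M -> M} :=
  to_linear (homothety_subproof a).
Fact homothety_linear : linear homothety_fun.
Proof. by move=> a b c; apply: linear_ext => x /=; rewrite scalerDl scalerA. Qed.
Definition homothety : {linear R^o -> {linear M -> M}} :=
  to_linear homothety_linear.
End NaturalMaps.

Definition tensor_map (R : comPzRingType) (M M' N N' : lmodType R)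
    (f : {linear M -> M'}) (g : {linear N -> N'}) :
    {linear tensor M N -> tensor M' N'} :=
  tensor_lift (hom_pre _ g \o (tens_right M' N' \o f)).

Lemma tensor_mapE (R : comPzRingType) (M M' N N' : lmodType R)
    (f : {linear M -> M'}) (g : {linear N -> N'}) x y :
  tensor_map f g (tens x y) = tens (f x) (g y).
Proof. exact: tensor_liftE. Qed.

(* Chain complexes concentrated in degrees >= 0; diff n is the differential
   from degree n + 1 to degree n. *)
Record complex (R : comPzRingType) := Complex {
  obj :> nat -> lmodType R;
  diff : forall n, {linear obj n.+1 -> obj n};
  diffK : forall n x, diff n (diff n.+1 x) = 0
}.

Record cocomplex (R : comPzRingType) := Cocomplex {
  coobj :> nat -> lmodType R;
  codiff : forall n, {linear coobj n -> coobj n.+1};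
  codiffK : forall n x, codiff n.+1 (codiff n x) = 0
}.

Section Homology.
Variable R : comPzRingType.

(* Ker g / Im f *)
Definition middle_homology (A B D : lmodType R) (f : {linear A -> B})
    (g : {linear B -> D}) : lmodType R :=
  quotmod (preim_submod (submod_incl (kernel_submod g)) (image_submod f)).

(* The differential leaving degree n; in degree 0 its target, nominally X_{-1},
   is replaced by X_0 and it is the zero map. *)
Definition diff_out (X : complex R) n : {linear X n -> X n.-1} :=
  if n is m.+1 then diff X m else 0.

Definition codiff_in (X : cocomplex R) n : {linear X n.-1 -> X n} :=
  if n is m.+1 then codiff X m else 0.

Definition homology (X : complex R) n : lmodType R :=
  middle_homology (diff X n) (diff_out X n).

Definition cohomology (X : cocomplex R) n : lmodType R :=
  middle_homology (codiff_in X n) (codiff X n).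

Definition is_zero (M : lmodType R) : Prop := forall x : M, x = 0.

Definition isomorphic (M N : lmodType R) : Prop :=
  exists f : {linear M -> N}, bijective f.

Definition acyclic (X : complex R) : Prop := forall n, is_zero (homology X n).

Fact tensor_complexK (X : complex R) (N : lmodType R) n x :
  tensor_map (diff X n) (idfun : {linear N -> N})
    (tensor_map (diff X n.+1) (idfun : {linear N -> N}) x) = 0.
Proof.
pose f m := tensor_map (diff X m) (idfun : {linear N -> N}).
apply: (@tensor_ext _ _ _ _ (f n \o f n.+1) 0) => y z.
apply: (_ : f n (f n.+1 (tens y z)) = 0); rewrite /f !tensor_mapE diffK.
exact: (linear0 (tens_left_fun (X n) z)).
Qed.

Definition tensor_complex (X : complex R) (N : lmodType R) : complex R :=
  Complex (@tensor_complexK X N).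

Fact hom_to_complexK (Y : lmodType R) (X : complex R) n
    (f : {linear Y -> X n.+2}) :
  hom_post Y (diff X n) (hom_post Y (diff X n.+1) f) = 0.
Proof. by apply: linear_ext => x /=; rewrite diffK. Qed.

Definition hom_to_complex (Y : lmodType R) (X : complex R) : complex R :=
  Complex (@hom_to_complexK Y X).

Fact hom_from_complexK (X : complex R) (Y : lmodType R) n
    (f : {linear X n -> Y}) :
  hom_pre Y (diff X n.+1) (hom_pre Y (diff X n) f) = 0.
Proof. by apply: linear_ext => x /=; rewrite diffK linear0. Qed.

Definition hom_from_complex (X : complex R) (Y : lmodType R) : cocomplex R :=
  Cocomplex (@hom_from_complexK X Y).

End Homology.

Section Resolution.
Variables (R : comPzRingType) (M : lmodType R).

Definition free_cover (N : lmodType R) : {linear free_mod R N -> N} := free_lift id.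

Fixpoint syzygy n : lmodType R :=
  if n is m.+1 then submod (kernel_submod (free_cover (syzygy m))) else M.

Definition free_res_diff n :
    {linear free_mod R (syzygy n.+1) -> free_mod R (syzygy n)} :=
  submod_incl (kernel_submod (free_cover (syzygy n))) \o free_cover (syzygy n.+1).

Fact free_res_diffK n x : free_res_diff n (free_res_diff n.+1 x) = 0.
Proof.
have -> : free_res_diff n.+1 x = val (free_cover (syzygy n.+2) x) by [].
case: (free_cover (syzygy n.+2) x) => y /= /eqP yK.
have E := linear0 (submod_incl (kernel_submod (free_cover (syzygy n)))).
by apply: etrans E; congr (submod_val _); exact: yK.
Qed.

(* The canonical free resolution
   ... -> free(K_2) -> free(K_1) -> free(M) of M, where K_0 = M and K_{n+1} is
   the kernel of the canonical surjection free(K_n) -> K_n. *)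
Definition free_res : complex R := Complex free_res_diffK.

End Resolution.

Section Derived.
Variable R : comPzRingType.
Implicit Types M N : lmodType R.

Definition Tor i M N : lmodType R := homology (tensor_complex (free_res M) N) i.

Definition Ext i M N : lmodType R := cohomology (hom_from_complex (free_res M) N) i.

Definition finitely_generated M : Prop :=
  exists (n : nat) (e : 'I_n -> M),
    forall x, exists a : 'I_n -> R, x = \sum_i a i *: e i.

Definition noetherian : Prop :=
  forall I : submodClosed R^o, finitely_generated (submod I).

Definition projective (P : lmodType R) : Prop :=
  forall (A B : lmodType R) (g : {linear A -> B}) (f : {linear P -> B}),
    (forall b, exists a, g a = b) ->
    exists h : {linear P -> A}, forall x, g (h x) = f x.

Definition exact_at (A B D : lmodType R) (f : {linear A -> B})
  (g : {linear B -> D}) : Prop := forall b, g b = 0 <-> exists a, f a = b.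

Definition flat (F : lmodType R) : Prop :=
  forall (A B D : lmodType R) (f : {linear A -> B}) (g : {linear B -> D}),
    exact_at f g ->
    exact_at (tensor_map (idfun : {linear F -> F}) f)
             (tensor_map (idfun : {linear F -> F}) g).

Record semidualizing (C : lmodType R) : Prop := Semidualizing {
  semidualizing_fg : finitely_generated C;
  semidualizing_homothety : bijective (homothety C);
  semidualizing_Ext : forall i, (1 <= i)%N -> is_zero (Ext i C C)
}.

Record auslander (C M : lmodType R) : Prop := Auslander {
  auslander_Tor : forall i, (1 <= i)%N -> is_zero (Tor i C M);
  auslander_Ext : forall i, (1 <= i)%N -> is_zero (Ext i C (tensor C M));
  auslander_map : bijective (tens_left C M)
}.

Record bass (C M : lmodType R) : Prop := Bass {
  bass_Ext : forall i, (1 <= i)%N -> is_zero (Ext i C M);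
  bass_Tor : forall i, (1 <= i)%N -> is_zero (Tor i C {linear C -> M});
  bass_map : bijective (evaluation C M)
}.

Definition C_projective (C X : lmodType R) : Prop :=
  exists2 P : lmodType R, projective P & isomorphic X (tensor P C).

Definition C_flat (C X : lmodType R) : Prop :=
  exists2 F : lmodType R, flat F & isomorphic X (tensor F C).

Section Augmented.
Variables (X : complex R) (M : lmodType R) (aug : {linear X 0%N -> M}).
Hypothesis augK : forall x, aug (diff X 0 x) = 0.

Definition augmented_obj n : lmodType R := if n is m.+1 then X m else M.

Definition augmented_diff n :
    {linear augmented_obj n.+1 -> augmented_obj n} :=
  if n is m.+1 then diff X m else aug.

Fact augmented_diffK n x : augmented_diff n (augmented_diff n.+1 x) = 0.
Proof. by case: n x => [|n] x /=; rewrite ?augK ?diffK. Qed.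

(* X^+, with M in degree 0 and X_n in degree n + 1 *)
Definition augmented : complex R := Complex augmented_diffK.
End Augmented.

Record proper_resolution (cls : lmodType R -> Prop) (M : lmodType R) :=
  ProperResolution {
    res_complex :> complex R;
    res_cls : forall n, cls (res_complex n);
    res_aug : {linear res_complex 0%N -> M};
    res_augK : forall x, res_aug (diff res_complex 0 x) = 0;
    res_proper : forall Y, cls Y ->
      acyclic (hom_to_complex Y (augmented res_augK))
  }.

(* Tor^{X M}_i(M, N), computed from a given proper X-resolution Q of M *)
Definition relative_Tor (cls : lmodType R -> Prop) (M : lmodType R)
    (Q : proper_resolution cls M) (i : nat) (N : lmodType R) : lmodType R :=
  homology (tensor_complex Q N) i.

End Derived.

(* Main.v *)
From HB Require Import structures.
Require Import Defs.
From mathcomp Require Import all_boot all_order all_algebra.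
From mathcomp Require Import boolp classical_sets functions cardinality.

(** Let [Q] be a proper resolution of [M] by modules [F (x) C] with [F] flat;
projective modules being flat, this covers both cases. The idea is to show that
[Q] is a genuine resolution of [M], and that its terms are acyclic for
[- (x) N]; then it computes the ordinary Tor(M, N).

Exactness. Properness against [C = R (x) C] says that [Hom(C, Q^+)] is exact.
As [C] is finitely presented and [R = Hom(C, C)], for flat [F] one has
[Hom(C, F (x) C) = F] ([tens_right_bijective]), so [Hom(C, Q)] is a flat
resolution of [Hom(C, M)], and evaluation [C (x) Hom(C, Q_p) -> Q_p] is
bijective ([C_flat_evaluation]). Since [M] is in the Bass class,
Tor(C, Hom(C, M)) vanishes in positive degrees, so [C (x) Hom(C, Q^+)] is exact
([Tor_vanishing_flip]); evaluation identifies it with [Q^+].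

Acyclicity. Let [L] be the augmented free resolution of [N]. Since [N] is in the
Auslander class, Tor(C, N) vanishes in positive degrees, so [C (x) L] is exact,
and so is [F (x) C (x) L] for [F] flat ([flat_tensor_exact]). Hence [Q] and the
free resolution of [M] both satisfy the hypotheses of [Tor_acyclic_resolution].

The homological engine behind both steps is [tensor_balance]: if, in the double
complex [X (x) Y] of two augmented complexes, all rows and columns except those
of index 0 are exact, then row 0 and column 0 have the same homology in every
degree. *)

Set Implicit Arguments.
Unset Strict Implicit.
Unset Printing Implicit Defensive.

Import GRing.Theory.
Local Open Scope ring_scope.

(** * Linear maps and homology *)

Section Linear.
Variable R : comPzRingType.
Implicit Types A B D M N P : lmodType R.

Lemma linear_bijective A B (f : {linear A -> B}) :
  (forall x, f x = 0 -> x = 0) -> (forall y, exists x, f x = y) -> bijective f.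
Proof.
move=> fI fS; have inv y : {x | f x = y} by exact: cid (fS y).
have invK y : f (sval (inv y)) = y by exact: svalP (inv y).
exists (fun y => sval (inv y)) => [x|y] //.
by apply/eqP; rewrite -subr_eq0; apply/eqP/fI; rewrite linearB invK subrr.
Qed.

Lemma bijective_ker0 A B (f : {linear A -> B}) x : bijective f -> f x = 0 -> x = 0.
Proof. by move=> /bij_inj fI fx; apply: fI; rewrite fx linear0. Qed.

Lemma bijective_surj A B (f : {linear A -> B}) y : bijective f -> exists x, f x = y.
Proof. by case=> g _ gK; exists (g y). Qed.

(** Isomorphisms are built from linear relations, so that a zigzag of chain
maps can be used without choosing lifts: the last hypothesis makes the relation
functional and injective at once. *)
Lemma isomorphic_of_rel A B (rel : A -> B -> Prop) :
  (forall a x y x' y', rel x x' -> rel y y' -> rel (a *: x + y) (a *: x' + y')) ->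
  (forall x, exists x', rel x x') -> (forall x', exists x, rel x x') ->
  (forall x x', rel x x' -> x = 0 <-> x' = 0) ->
  isomorphic A B.
Proof.
move=> relP tot surj rel0.
have uniq_rel x y y' : rel x y -> rel x y' -> y = y'.
  move=> xy xy'; apply/eqP; rewrite -subr_eq0; apply/eqP.
  apply: (rel0 (- x + x) _ _).1; last by rewrite addNr.
  by have := relP (-1) _ _ _ _ xy' xy; rewrite !scaleN1r (addrC (- y')).
pose f x := sval (cid (tot x)).
have fP x : rel x (f x) by exact: svalP (cid (tot x)).
have f_lin : linear f.
  by move=> a x y; apply: (uniq_rel (a *: x + y)); [exact: fP | apply: relP; exact: fP].
exists (to_linear f_lin); apply: linear_bijective => [x|y] /=.
  by move/(rel0 _ _ (fP x)).
by have [x xy] := surj y; exists x; exact: uniq_rel (fP x) xy.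
Qed.

Lemma isomorphic_sym A B : isomorphic A B -> isomorphic B A.
Proof.
case=> f f_bij.
apply: (isomorphic_of_rel (rel := fun y x => f x = y)) => [a y y' x x' <- <-|y|x|y x <-].
- by rewrite linearP.
- exact: bijective_surj.
- by exists (f x).
- by split=> [/(bijective_ker0 f_bij)|->] //; exact: linear0.
Qed.

Lemma isomorphic_trans A B D : isomorphic A B -> isomorphic B D -> isomorphic A D.
Proof. by case=> f ? [g ?]; exists (g \o f); exact: bij_comp. Qed.

End Linear.

Section MiddleHomology.
Variable R : comPzRingType.
Implicit Types A B D : lmodType R.

Lemma quot_pi_eq0 B (S : submodClosed B) (x : B) : quot_pi S x = 0 <-> x \in S.
Proof.
rewrite -[X in _ = X](linear0 (quot_pi S)) /=.
by split=> [/eqP|xS]; [|apply/eqP]; rewrite quot_eqE subr0.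
Qed.

Lemma homology_class0 A B D (f : {linear A -> B}) (g : {linear B -> D})
    (z : submod (kernel_submod g)) :
  quot_pi (preim_submod (submod_incl (kernel_submod g)) (image_submod f)) z = 0 <->
  exists a, f a = val z.
Proof.
split=> [/quot_pi_eq0/asboolP //|[a az]].
by apply/quot_pi_eq0/asboolP; exists a.
Qed.

Lemma homology_is_zero A B D (f : {linear A -> B}) (g : {linear B -> D}) :
  is_zero (middle_homology f g) <-> (forall b, g b = 0 -> exists a, f a = b).
Proof.
split=> [H b gb|H q].
  have bK : b \in kernel_submod g by rewrite mem_kernel gb.
  by apply: (homology_class0 f (Submod bK)).1; exact: H.
have [z ->] := quot_pi_surj q; apply/homology_class0/H.
by case: z => z /= /eqP.
Qed.

(** The same principle on subquotients: a relation between representatives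
that respects cycles and boundaries in both directions. *)
Lemma isomorphic_homology A B D A' B' D' (f : {linear A -> B}) (g : {linear B -> D})
    (f' : {linear A' -> B'}) (g' : {linear B' -> D'}) (rel : B -> B' -> Prop) :
  (forall a x y x' y', rel x x' -> rel y y' -> rel (a *: x + y) (a *: x' + y')) ->
  (forall x, g x = 0 -> exists2 x', rel x x' & g' x' = 0) ->
  (forall x', g' x' = 0 -> exists2 x, rel x x' & g x = 0) ->
  (forall x x', rel x x' -> (exists a, f a = x) <-> (exists a, f' a = x')) ->
  isomorphic (middle_homology f g) (middle_homology f' g').
Proof.
move=> relP tot surj rel_im.
set K := kernel_submod g; set K' := kernel_submod g'.
set S := preim_submod (submod_incl K) (image_submod f).
set S' := preim_submod (submod_incl K') (image_submod f').
apply: (isomorphic_of_rel (rel := fun q q' => exists z z',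
  [/\ q = quot_pi S z, q' = quot_pi S' z' & rel (val z) (val z')])).
- move=> a _ _ _ _ [z [z' [-> -> zz']]] [y [y' [-> -> yy']]].
  exists (a *: z + y), (a *: z' + y'); split; rewrite ?linearP //.
  exact: relP.
- move=> q; have [z ->] := quot_pi_surj q.
  have /tot[x' zx' gx'] : g (val z) = 0 by case: z => z /= /eqP.
  have x'K : x' \in kernel_submod g' by rewrite mem_kernel gx'.
  by exists (quot_pi S' (Submod x'K)), z, (Submod x'K).
- move=> q; have [z ->] := quot_pi_surj q.
  have /surj[x zx gx] : g' (val z) = 0 by case: z => z /= /eqP.
  have xK : x \in kernel_submod g by rewrite mem_kernel gx.
  by exists (quot_pi S (Submod xK)), (Submod xK), z.
- move=> _ _ [z [z' [-> -> zz']]].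
  have h := rel_im _ _ zz'.
  by split=> /homology_class0 ?; apply/homology_class0; apply/h.
Qed.

End MiddleHomology.

(** * Tensor products *)

Section TensorTools.
Variable R : comPzRingType.
Implicit Types A B D M N P : lmodType R.

(** The universal property in the form of a function linear in each variable,
the currying being done once and for all. *)
Definition tensor_lift2 M N P (b : M -> N -> P) (bl : forall y, linear (b^~ y))
    (br : forall x, linear (b x)) : {linear tensor M N -> P} :=
  tensor_lift (to_linear (fun a x x' =>
    linear_ext (f := to_linear (br (a *: x + x')))
      (g := a *: to_linear (br x) + to_linear (br x')) (fun y => bl y a x x'))).

Lemma tensor_lift2E M N P (b : M -> N -> P) bl br x y :
  tensor_lift2 (b := b) bl br (tens x y) = b x y.
Proof. exact: tensor_liftE. Qed.

Lemma tens0l M N (y : N) : tens (0 : M) y = 0.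
Proof. exact: (linear0 (tens_left_fun M y)). Qed.

Lemma tens0r M N (x : M) : tens x (0 : N) = 0.
Proof. exact: (linear0 (tens_right_fun N x)). Qed.

Lemma tensZl M N a (x : M) (y : N) : tens (a *: x) y = a *: tens x y.
Proof. exact: (linearZ_LR (tens_left_fun M y)). Qed.

Lemma tensZr M N a (x : M) (y : N) : tens x (a *: y) = a *: tens x y.
Proof. exact: (linearZ_LR (tens_right_fun N x)). Qed.

Lemma tensDl M N (x x' : M) (y : N) : tens (x + x') y = tens x y + tens x' y.
Proof. exact: (linearD (tens_left_fun M y)). Qed.

Lemma tensDr M N (x : M) (y y' : N) : tens x (y + y') = tens x y + tens x y'.
Proof. exact: (linearD (tens_right_fun N x)). Qed.

Lemma tensor_ind M N (K : tensor M N -> Prop) :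
  (forall x y, K (tens x y)) -> (forall z w, K z -> K w -> K (z + w)) ->
  forall z, K z.
Proof.
move=> Ktens KD.
(* The quotient map by the span of the pure tensors kills them, hence is 0. *)
pose S := span_submod [set z : tensor M N | exists x y, z = tens x y].
have S_all z : z \in S.
  apply/quot_pi_eq0.
  apply: (@tensor_ext _ _ _ _ (quot_pi S) 0) => x y.
  by apply/quot_pi_eq0/asboolP => T; apply; exists x, y.
(* [K] is only additive; [L] is the largest submodule inside it. *)
pose L := fun z => `[< forall a, K (a *: z) >].
have L_closed : GRing.subsemimod_closed (L : {pred tensor M N}).
  split; first split.
  - apply/asboolP => a; rewrite scaler0 -(tens0l M (0 : N)).
    exact: Ktens.
  - move=> x y /asboolP Lx /asboolP Ly; apply/asboolP => a.
    by rewrite scalerDr; exact: KD.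
  - move=> a x /asboolP Lx; apply/asboolP => b; rewrite scalerA; exact: Lx.
pose LS : submodClosed (tensor M N) :=
  HB.pack (L : {pred tensor M N}) (GRing.isSubmodClosed.Build R _ L L_closed).
move=> z; rewrite -[z]scale1r.
have /asboolP/(_ LS) : z \in S by [].
have -> : (z \in LS) = `[< forall a, K (a *: z) >] by [].
move=> h; apply: (asboolW (h _)) => _ [x [y ->]].
by apply/asboolP => a; rewrite -tensZl.
Qed.

(** Simplifying a composite of linear maps would also unfold the maps
composed; rewriting with this equation does not. *)
Lemma linear_compE A B D (f : {linear B -> D}) (g : {linear A -> B}) x :
  (f \o g : {linear A -> D}) x = f (g x).
Proof. by []. Qed.

Lemma tensor_map_comp M M' M'' N N' N'' (f : {linear M -> M'})
    (f' : {linear M' -> M''}) (g : {linear N -> N'}) (g' : {linear N' -> N''}) z :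
  tensor_map f' g' (tensor_map f g z) = tensor_map (f' \o f) (g' \o g) z.
Proof.
apply: (@tensor_ext _ _ _ _ (tensor_map f' g' \o tensor_map f g)) => x y.
by rewrite !linear_compE !tensor_mapE.
Qed.

Lemma eq_tensor_map M M' N N' (f f' : {linear M -> M'}) (g g' : {linear N -> N'}) :
  f =1 f' -> g =1 g' -> tensor_map f g =1 tensor_map f' g'.
Proof.
by move=> ff' gg'; apply: tensor_ext => x y; rewrite !tensor_mapE ff' gg'.
Qed.

Lemma tensor_map_id M N (f : {linear M -> M}) (g : {linear N -> N}) :
  f =1 id -> g =1 id -> tensor_map f g =1 id.
Proof.
move=> f1 g1; apply: (@tensor_ext _ _ _ _ _ idfun) => x y.
by rewrite tensor_mapE f1 g1.
Qed.

Lemma tensor_map_eq0l M M' N N' (f : {linear M -> M'}) (g : {linear N -> N'}) :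
  (forall x, f x = 0) -> forall z, tensor_map f g z = 0.
Proof.
move=> f0; apply: (@tensor_ext _ _ _ _ _ 0) => x y.
by rewrite tensor_mapE f0 tens0l.
Qed.

Lemma tensor_map_eq0r M M' N N' (f : {linear M -> M'}) (g : {linear N -> N'}) :
  (forall x, g x = 0) -> forall z, tensor_map f g z = 0.
Proof.
move=> g0; apply: (@tensor_ext _ _ _ _ _ 0) => x y.
by rewrite tensor_mapE g0 tens0r.
Qed.

Definition tensor_swap M N : {linear tensor M N -> tensor N M} :=
  tensor_lift (tens_left N M).

Lemma tensor_swapE M N (x : M) (y : N) : tensor_swap M N (tens x y) = tens y x.
Proof. exact: tensor_liftE. Qed.

Lemma tensor_swapK M N : cancel (tensor_swap M N) (tensor_swap N M).
Proof.
apply: (@tensor_ext _ _ _ _ (tensor_swap N M \o tensor_swap M N) idfun) => x y.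
by rewrite !linear_compE !tensor_swapE.
Qed.

Lemma tensor_swap_map M M' N N' (f : {linear M -> M'}) (g : {linear N -> N'}) z :
  tensor_swap M' N' (tensor_map f g z) = tensor_map g f (tensor_swap M N z).
Proof.
apply: (@tensor_ext _ _ _ _ (tensor_swap M' N' \o tensor_map f g)
  (tensor_map g f \o tensor_swap M N)) => x y.
by rewrite !linear_compE !(tensor_mapE, tensor_swapE).
Qed.

End TensorTools.

(** * Exactness and flatness *)

Section Exactness.
Variable R : comPzRingType.
Implicit Types A B D M N P : lmodType R.

(** A cycle is sent by [i] to the primed sequence, lifted there, and the lift is
brought back by [u]. *)
Lemma exact_at_retract A B D A' B' D' (f : {linear A -> B}) (g : {linear B -> D})
    (f' : {linear A' -> B'}) (g' : {linear B' -> D'})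
    (u : {linear A' -> A}) (i : {linear B -> B'}) (r : {linear B' -> B})
    (v : {linear D -> D'}) :
  cancel i r -> (forall x, r (f' x) = f (u x)) -> (forall x, g' (i x) = v (g x)) ->
  (forall x, g (f x) = 0) -> exact_at f' g' -> exact_at f g.
Proof.
move=> irK rf gi gf ex b; split=> [gb|[a <-] //].
have /ex[a ab] : g' (i b) = 0 by rewrite gi gb linear0.
by exists (u a); rewrite -rf ab irK.
Qed.

Lemma exact_at_comp0 A B D (f : {linear A -> B}) (g : {linear B -> D}) :
  exact_at f g -> forall x, g (f x) = 0.
Proof. by move=> ex x; apply/ex; exists x. Qed.

Lemma tensor_comp0l A B D N (f : {linear A -> B}) (g : {linear B -> D}) :
  exact_at f g -> forall z,
  tensor_map g (idfun : {linear N -> N}) (tensor_map f (idfun : {linear N -> N}) z) = 0.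
Proof.
move=> ex z; rewrite tensor_map_comp; apply: tensor_map_eq0l => x.
exact: exact_at_comp0 ex x.
Qed.

Lemma tensor_comp0r A B D N (f : {linear A -> B}) (g : {linear B -> D}) :
  exact_at f g -> forall z,
  tensor_map (idfun : {linear N -> N}) g (tensor_map (idfun : {linear N -> N}) f z) = 0.
Proof.
move=> ex z; rewrite tensor_map_comp; apply: tensor_map_eq0r => x.
exact: exact_at_comp0 ex x.
Qed.

Lemma flat_retract (F F' : lmodType R) (i : {linear F -> F'}) (r : {linear F' -> F}) :
  cancel i r -> flat F' -> flat F.
Proof.
move=> irK flatF' A B D f g ex.
apply: (exact_at_retract (u := tensor_map r idfun) (i := tensor_map i idfun)
  (r := tensor_map r idfun) (v := tensor_map i idfun) _ _ _ _ (flatF' _ _ _ _ _ ex)).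
- by move=> z; rewrite tensor_map_comp tensor_map_id.
- by move=> z; rewrite !tensor_map_comp; exact: eq_tensor_map.
- by move=> z; rewrite !tensor_map_comp; exact: eq_tensor_map.
- exact: tensor_comp0r.
Qed.

Lemma flat_right (F A B D : lmodType R) (f : {linear A -> B}) (g : {linear B -> D}) :
  flat F -> exact_at f g ->
  exact_at (tensor_map f (idfun : {linear F -> F})) (tensor_map g (idfun : {linear F -> F})).
Proof.
move=> flatF ex.
apply: (exact_at_retract (u := tensor_swap F A) (i := tensor_swap B F)
  (r := tensor_swap F B) (v := tensor_swap D F) _ _ _ _ (flatF _ _ _ _ _ ex)).
- exact: tensor_swapK.
- by move=> z; rewrite tensor_swap_map.
- by move=> z; rewrite tensor_swap_map.
- exact: tensor_comp0l.
Qed.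

Lemma tensor_surj M M' N N' (f : {linear M -> M'}) (g : {linear N -> N'}) :
  (forall y, exists x, f x = y) -> (forall y, exists x, g x = y) ->
  forall w, exists z, tensor_map f g z = w.
Proof.
move=> fS gS; apply: tensor_ind => [x y|_ _ [z <-] [w <-]].
  have [x' <-] := fS x; have [y' <-] := gS y.
  by exists (tens x' y'); rewrite tensor_mapE.
by exists (z + w); rewrite linearD.
Qed.

(** Since [g] is onto, [b (x) n] modulo the image of [A (x) N] depends on [g b]
only; this gives a map out of [D (x) N] through which the projection of
[B (x) N] onto the cokernel factors. *)
Lemma tensor_right_exact A B D N (f : {linear A -> B}) (g : {linear B -> D}) :
  exact_at f g -> (forall d, exists b, g b = d) ->
  exact_at (tensor_map f (idfun : {linear N -> N})) (tensor_map g (idfun : {linear N -> N})).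
Proof.
move=> ex gS z; split=> [gz|[a <-]]; last exact: tensor_comp0l.
pose I := image_submod (tensor_map f (idfun : {linear N -> N})).
pose lift d := sval (cid (gS d)).
have liftK d : g (lift d) = d by exact: svalP (cid (gS d)).
pose q b n : quotmod I := quot_pi I (tens b n).
have q_eq b b' n : g b = g b' -> q b n = q b' n.
  move=> gbb'; apply/eqP; rewrite -subr_eq0 -linearB; apply/eqP/quot_pi_eq0/asboolP.
  have /ex[a ab] : g (b - b') = 0 by rewrite linearB gbb' subrr.
  exists (tens a n); rewrite tensor_mapE ab.
  exact: (linearB (tens_left_fun B n)).
have ql n : linear (fun d => q (lift d) n).
  move=> a d d'; rewrite -[RHS](linearP (quot_pi I)) -tens_linearl.
  by apply: q_eq; rewrite linearP !liftK.
have qr d : linear (q (lift d)).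
  by move=> a n n'; rewrite /q tens_linearr linearP.
pose h := tensor_lift2 ql qr.
have hE : h \o tensor_map g (idfun : {linear N -> N}) =1 quot_pi I.
  apply: tensor_ext => b n; rewrite linear_compE tensor_mapE.
  by apply: etrans (tensor_lift2E _ _ _ _) _; apply: q_eq; rewrite liftK.
have /quot_pi_eq0/asboolP : quot_pi I z = 0.
  by rewrite -hE; apply: etrans (congr1 h gz) (linear0 _).
by case=> a; exists a.
Qed.

End Exactness.

(** * Free, projective and flat modules *)

Section FreeFlat.
Variable R : comPzRingType.
Implicit Types A B D M N P : lmodType R.

Fact free_coef_linear (X : choiceType) (x : X) :
  linear (fun u : free_mod R X => free_coef u x : R^o).
Proof. by []. Qed.

(** The component at [x] of an element of [free (x) B], which is a direct sum of
copies of [B] indexed by the basis. *)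
Definition free_tensor_coef (X : choiceType) B (x : X) :
    {linear tensor (free_mod R X) B -> B} :=
  tensor_lift (homothety B \o to_linear (free_coef_linear x)).

Lemma free_tensor_coefE (X : choiceType) B (x : X) (u : free_mod R X) (c : B) :
  free_tensor_coef B x (tens u c) = free_coef u x *: c.
Proof. by rewrite tensor_liftE. Qed.

Lemma free_tensor_coef_map (X : choiceType) B D (g : {linear B -> D}) (x : X) z :
  free_tensor_coef D x (tensor_map idfun g z) = g (free_tensor_coef B x z).
Proof.
apply: (@tensor_ext _ _ _ _ (free_tensor_coef D x \o tensor_map idfun g)
  (g \o free_tensor_coef B x)) => u c.
rewrite !linear_compE tensor_mapE !free_tensor_coefE.
by rewrite [RHS]linearZ_LR.
Qed.

Lemma free_mod_expansion (X : choiceType) (u : free_mod R X) (s : seq X) : uniq s ->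
  (forall x, free_coef u x != 0 -> x \in s) ->
  u = \sum_(x <- s) free_coef u x *: free_base R x.
Proof.
move=> us su; rewrite -(free_lift_seq (@free_base R X) us su).
apply: (@free_ext _ _ _ idfun (free_lift (@free_base R X))) => x.
by rewrite free_lift_base.
Qed.

(** The support is only bounded, not computed: asking for the expansion over
every larger support is what makes the statement stable under sums. *)
Lemma free_tensor_expansion (X : choiceType) B (z : tensor (free_mod R X) B) :
  exists2 s : seq X, uniq s &
    forall s', uniq s' -> {subset s <= s'} ->
    z = \sum_(x <- s') tens (free_base R x) (free_tensor_coef B x z).
Proof.
elim/tensor_ind: z => [u c|z w [s us sP] [t ut tP]].
  have /finite_seqP[s sE] := free_coef_finite u.
  exists (undup s) => [|s' us' ss']; first exact: undup_uniq.
  rewrite {1}(@free_mod_expansion _ u s') // => [|x ux]; last first.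
    apply: ss'; rewrite mem_undup.
    by have : [set` s]%classic x by rewrite -sE.
  rewrite -[LHS]/(tens_left_fun _ c _) linear_sum; apply: eq_bigr => x _.
  by rewrite free_tensor_coefE /= tensZl tensZr.
exists (undup (s ++ t)) => [|s' us' ss']; first exact: undup_uniq.
rewrite {1}(sP s') // => [|x xs]; last first.
  by apply: ss'; rewrite mem_undup mem_cat xs.
rewrite {1}(tP s') // => [|x xt]; last first.
  by apply: ss'; rewrite mem_undup mem_cat xt orbT.
rewrite -big_split; apply: eq_bigr => x _.
by rewrite linearD tensDr.
Qed.

(** A kernel element of [free (x) B] has all its components in the kernel of
[B -> D]; lifting the finitely many relevant ones lifts the element. *)
Lemma free_flat (X : choiceType) : flat (free_mod R X).
Proof.
move=> A B D f g ex z; split=> [gz|[a <-]]; last exact: tensor_comp0r.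
have lift x : exists a, f a = free_tensor_coef B x z.
  by apply/ex; rewrite -free_tensor_coef_map gz linear0.
have [s us /(_ s us) zE] := free_tensor_expansion z.
have [a aE] : {a : X -> A | forall x, f (a x) = free_tensor_coef B x z}.
  by exists (fun x => sval (cid (lift x))) => x; exact: svalP (cid (lift x)).
exists (\sum_(x <- s) tens (free_base R x) (a x)).
rewrite linear_sum (zE (fun x xs => xs)); apply: eq_bigr => x _.
by rewrite tensor_mapE aE.
Qed.

Lemma free_cover_surj N (x : N) : exists u, free_cover N u = x.
Proof. by exists (free_base R x); exact: free_lift_base. Qed.

Lemma projective_flat P : projective P -> flat P.
Proof.
move=> projP.
have [h hK] := projP _ _ (free_cover P) idfun (@free_cover_surj P).
exact: (@flat_retract _ _ _ h (free_cover P) hK (@free_flat P)).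
Qed.

Lemma regular_projective : projective R^o.
Proof.
move=> A B g f gS; have [a ga] := gS (f 1).
have h_lin : linear (fun r : R^o => (r : R) *: a).
  by move=> b r s; rewrite scalerDl scalerA.
exists (to_linear h_lin) => r; rewrite [LHS]linearZ_LR ga -linearZ_LR.
by congr (f _); exact: mulr1.
Qed.

Lemma regular_tensor M : isomorphic (tensor R^o M) M.
Proof.
pose f := tensor_lift (homothety M).
exists f; exists (tens_right R^o M 1) => [z|x].
  apply: (@tensor_ext _ _ _ _ (tens_right R^o M 1 \o f) idfun) => r y.
  rewrite linear_compE tensor_liftE [LHS]/= tensZr -tensZl.
  by congr tens; exact: mulr1.
by apply: etrans (tensor_liftE _ _ _) _; exact: scale1r.
Qed.

End FreeFlat.

Section Associativity.
Variables (R : comPzRingType) (L M N : lmodType R).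

Definition tensor_assoc_at (x : L) (y : M) : {linear N -> tensor L (tensor M N)} :=
  tens_right_fun (tensor M N) x \o tens_right_fun N y.

Fact tensor_assoc_linearl y : linear (tensor_assoc_at ^~ y).
Proof. by move=> a x x'; apply: linear_ext => z; exact: tens_linearl. Qed.

Fact tensor_assoc_linearr x : linear (tensor_assoc_at x).
Proof.
move=> a y y'; apply: linear_ext => z; rewrite -[RHS](tens_linearr x).
by congr tens; exact: tens_linearl.
Qed.

Definition tensor_assoc : {linear tensor (tensor L M) N -> tensor L (tensor M N)} :=
  tensor_lift (tensor_lift2 tensor_assoc_linearl tensor_assoc_linearr).

Lemma tensor_assocE x y z : tensor_assoc (tens (tens x y) z) = tens x (tens y z).
Proof. by rewrite tensor_liftE tensor_lift2E. Qed.

Definition tensor_unassoc_at (x : L) : {linear tensor M N -> tensor (tensor L M) N} :=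
  tensor_map (tens_right_fun M x) idfun.

Fact tensor_unassoc_linear z : linear (tensor_unassoc_at ^~ z).
Proof.
move=> a x x'.
apply: (@tensor_ext _ _ _ _ (tensor_unassoc_at (a *: x + x'))
  (a *: tensor_unassoc_at x + tensor_unassoc_at x')) => y w.
rewrite linear_addE linear_scaleE !tensor_mapE -tens_linearl.
by congr tens; exact: tens_linearl.
Qed.

Definition tensor_unassoc : {linear tensor L (tensor M N) -> tensor (tensor L M) N} :=
  tensor_lift2 tensor_unassoc_linear (fun x => linearP (tensor_unassoc_at x)).

Lemma tensor_unassocE x y z : tensor_unassoc (tens x (tens y z)) = tens (tens x y) z.
Proof. by rewrite tensor_lift2E tensor_mapE. Qed.

Lemma tensor_assocK : cancel tensor_assoc tensor_unassoc.
Proof.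
elim/tensor_ind => [t z|t t' IH IH']; last by rewrite !linearD IH IH'.
elim/tensor_ind: t => [x y|t t' IH IH'].
  by rewrite tensor_assocE tensor_unassocE.
by rewrite tensDl !linearD IH IH'.
Qed.

End Associativity.

Lemma tensor_assoc_map (R : comPzRingType) (L M N N' : lmodType R)
    (g : {linear N -> N'}) z :
  tensor_assoc L M N' (tensor_map idfun g z) =
  tensor_map idfun (tensor_map idfun g) (tensor_assoc L M N z).
Proof.
elim/tensor_ind: z => [t z|z z' IH IH']; last by rewrite !linearD IH IH'.
elim/tensor_ind: t => [x y|t t' IH IH'].
  by rewrite tensor_mapE !tensor_assocE !tensor_mapE.
by rewrite tensDl !linearD IH IH'.
Qed.

Lemma tensor_unassoc_map (R : comPzRingType) (L M N N' : lmodType R)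
    (g : {linear N -> N'}) z :
  tensor_unassoc L M N' (tensor_map idfun (tensor_map idfun g) z) =
  tensor_map idfun g (tensor_unassoc L M N z).
Proof.
elim/tensor_ind: z => [x t|z z']; last by rewrite !linearD => -> ->.
elim/tensor_ind: t => [y z|t t' IH IH'].
  by rewrite 2!tensor_mapE 2!tensor_unassocE tensor_mapE.
by rewrite tensDr !linearD IH IH'.
Qed.

(** Modules [F (x) C] are as good as [C] itself for exactness: tensoring with them
is tensoring with [C], then with the flat module [F]. *)
Lemma flat_tensor_exact (R : comPzRingType) (F C A B D : lmodType R)
    (f : {linear A -> B}) (g : {linear B -> D}) :
  flat F -> (forall x, g (f x) = 0) ->
  exact_at (tensor_map (idfun : {linear C -> C}) f) (tensor_map (idfun : {linear C -> C}) g) ->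
  exact_at (tensor_map (idfun : {linear tensor F C -> tensor F C}) f)
           (tensor_map (idfun : {linear tensor F C -> tensor F C}) g).
Proof.
move=> flatF gf0 ex.
apply: (exact_at_retract (u := tensor_unassoc F C A) (i := tensor_assoc F C B)
  (r := tensor_unassoc F C B) (v := tensor_assoc F C D) _ _ _ _ (flatF _ _ _ _ _ ex)).
- exact: tensor_assocK.
- exact: tensor_unassoc_map.
- by move=> z; rewrite tensor_assoc_map.
- by move=> z; rewrite tensor_map_comp; apply: tensor_map_eq0r.
Qed.

(** * Balance of the tensor product of two complexes *)

Section Balance.
Variable R : comPzRingType.

Fact pair_linear_subproof (B D E : lmodType R) (f : {linear B -> D}) (g : {linear B -> E}) :
  linear (fun x => (f x, g x)).
Proof. by move=> a x y; rewrite !linearP. Qed.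

Definition pair_linear (B D E : lmodType R) (f : {linear B -> D}) (g : {linear B -> E}) :
  {linear B -> (D * E)%type} := to_linear (pair_linear_subproof f g).

Lemma pair_linear_eq0 (B D E : lmodType R) (f : {linear B -> D}) (g : {linear B -> E}) x :
  pair_linear f g x = 0 <-> f x = 0 /\ g x = 0.
Proof. by split=> [[-> ->] | [fx gx]] //; rewrite /= fx gx. Qed.

Lemma diff_outK (X : complex R) n x : diff_out X n (diff X n x) = 0.
Proof. by case: n x => [|n] x //=; rewrite diffK. Qed.

Variables X Y : complex R.

Local Notation horiz p q := (tensor_map (diff X p) (idfun : {linear Y q -> Y q})).
Local Notation vert p q := (tensor_map (idfun : {linear X p -> X p}) (diff Y q)).
Local Notation horiz_out p q := (tensor_map (diff_out X p) (idfun : {linear Y q -> Y q})).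
Local Notation vert_out p q := (tensor_map (idfun : {linear X p -> X p}) (diff_out Y q)).

(** Receptor of the double complex [X (x) Y] at (p, q), in the terminology of
G. Bergman's salamander lemma: horizontal and vertical cycles modulo the
image of the diagonal map from (p + 1, q + 1). *)
Definition receptor p q : lmodType R :=
  middle_homology (tensor_map (diff X p) (diff Y q))
    (pair_linear (horiz_out p q) (vert_out p q)).

Lemma horiz_vert p q z : horiz p q (vert p.+1 q z) = tensor_map (diff X p) (diff Y q) z.
Proof. by rewrite tensor_map_comp; exact: eq_tensor_map. Qed.

Lemma vert_horiz p q z : vert p q (horiz p q.+1 z) = tensor_map (diff X p) (diff Y q) z.
Proof. by rewrite tensor_map_comp; exact: eq_tensor_map. Qed.

Lemma horizK p q z : horiz_out p q (horiz p q z) = 0.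
Proof. by rewrite tensor_map_comp; apply: tensor_map_eq0l => x; exact: diff_outK. Qed.

Lemma vertK p q z : vert_out p q (vert p q z) = 0.
Proof. by rewrite tensor_map_comp; apply: tensor_map_eq0r => x; exact: diff_outK. Qed.

Hypothesis rows : forall p q, exact_at (horiz p q.+1) (horiz_out p q.+1).
Hypothesis cols : forall p q, exact_at (vert p.+1 q) (vert_out p.+1 q).

(** Two elements correspond when they are the vertical and the horizontal
boundary of a common [w] in position (p + 1, q + 1). Exactness of column p + 1
and row q + 1 provides [w] from either side; two choices of [w] differ by a
boundary, which is absorbed by the diagonal map. *)
Lemma receptor_step p q : isomorphic (receptor p.+1 q) (receptor p q.+1).
Proof.
apply: (isomorphic_homology (rel := fun x x' => exists w,
  vert p.+1 q w = x /\ horiz p q.+1 w = x')).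
- move=> a _ _ _ _ [w [<- <-]] [v [<- <-]].
  by exists (a *: w + v); rewrite !linearP.
- move=> x /pair_linear_eq0[hx /cols[w wx]].
  exists (horiz p q.+1 w); first by exists w.
  apply/pair_linear_eq0; split; first exact: horizK.
  by rewrite [LHS]vert_horiz -horiz_vert wx.
- move=> x' /pair_linear_eq0[/rows[w wx] vx].
  exists (vert p.+1 q w); first by exists w.
  apply/pair_linear_eq0; split; last exact: vertK.
  by rewrite [LHS]horiz_vert -vert_horiz wx.
- move=> _ _ [w [<- <-]]; split=> -[a aw].
    have : vert p.+1 q (w - horiz p.+1 q.+1 a) = 0.
      by rewrite linearB vert_horiz aw subrr.
    move/(@cols p q.+1 _)=> [t tw]; exists t.
    rewrite -horiz_vert tw linearB -[RHS]subr0; congr (_ - _).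
    exact: (@horizK p.+1 q.+1 a).
have : horiz p q.+1 (w - vert p.+1 q.+1 a) = 0.
  by rewrite linearB horiz_vert aw subrr.
move/(@rows p.+1 q _)=> [t tw]; exists t.
rewrite -vert_horiz tw linearB -[RHS]subr0; congr (_ - _).
exact: (@vertK p.+1 q.+1 a).
Qed.

(** On the edge [q = 0] vertical cycles are no condition, and the vertical
differential into this edge is onto, so diagonal boundaries are all horizontal
boundaries. *)
Lemma receptor_left p :
  isomorphic (receptor p 0) (middle_homology (horiz p 0) (horiz_out p 0)).
Proof.
apply: (isomorphic_homology (rel := eq)) => [a x y _ _ <- <- //|x|x hx|x _ <-].
- by move/pair_linear_eq0 => [hx _]; exists x.
- exists x => //; apply/pair_linear_eq0; split=> //.
  exact: tensor_map_eq0r.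
- split=> -[a <-]; first by exists (vert p.+1 0 a); rewrite horiz_vert.
  have /cols[b <-] : vert_out p.+1 0 a = 0 by exact: tensor_map_eq0r.
  by exists b; rewrite horiz_vert.
Qed.

Lemma receptor_right q :
  isomorphic (receptor 0 q) (middle_homology (vert 0 q) (vert_out 0 q)).
Proof.
apply: (isomorphic_homology (rel := eq)) => [a x y _ _ <- <- //|x|x vx|x _ <-].
- by move/pair_linear_eq0 => [_ vx]; exists x.
- exists x => //; apply/pair_linear_eq0; split=> //.
  exact: tensor_map_eq0l.
- split=> -[a <-]; first by exists (horiz 0 q.+1 a); rewrite vert_horiz.
  have /rows[b <-] : horiz_out 0 q.+1 a = 0 by exact: tensor_map_eq0l.
  by exists b; rewrite vert_horiz.
Qed.

(** Receptors are constant along antidiagonals, and at the two ends of an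
antidiagonal they are the homologies of the two edges of the double
complex. *)
Theorem tensor_balance n :
  isomorphic (middle_homology (horiz n 0) (horiz_out n 0))
             (middle_homology (vert 0 n) (vert_out 0 n)).
Proof.
have walk p q : isomorphic (receptor p q) (receptor 0 (p + q)).
  elim: p q => [|p IH] q; first by exists idfun; exists id.
  apply: isomorphic_trans (receptor_step p q) _.
  by rewrite addSnnS; exact: IH.
apply: isomorphic_trans (isomorphic_sym (receptor_left n)) _.
by apply: isomorphic_trans (receptor_right n); have := walk n 0; rewrite addn0.
Qed.

End Balance.

(** * Noetherian rings and finite presentation *)

Section Noetherian.
Variable R : comPzRingType.
Implicit Types A B D M N P : lmodType R.

Lemma val_lincomb M (S : submodClosed M) n (a : 'I_n -> R) (d : 'I_n -> submod S) :
  val (\sum_j a j *: d j) = \sum_j a j *: val (d j).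
Proof. by rewrite raddf_sum. Qed.

Definition noetherian_module M : Prop :=
  forall S : submodClosed M, finitely_generated (submod S).

(** Generators of a submodule [S] of [B]: lifts of generators of its image in
[D], and images of generators of its preimage in [A]. *)
Lemma noetherian_extension A B D (f : {linear A -> B}) (g : {linear B -> D}) :
  exact_at f g -> noetherian_module A -> noetherian_module D -> noetherian_module B.
Proof.
move=> ex noethA noethD S.
pose gS : {linear submod S -> D} := g \o submod_incl S.
have [n [d dP]] := noethD (image_submod gS).
have [m [u uP]] := noethA (preim_submod f S).
have liftd j : exists s : submod S, g (val s) = val (d j).
  by case: (d j) => y /= /asboolP[s sy]; exists s.
have [s sE] : {s : 'I_n -> submod S | forall j, g (val (s j)) = val (d j)}.
  by exists (fun j => sval (cid (liftd j))) => j; exact: svalP (cid (liftd j)).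
have fuS k : f (val (u k)) \in S by case: (u k).
exists (n + m)%N, (fun i => match fintype.split i with
  | inl j => s j | inr k => Submod (fuS k) end) => x.
have gxT : gS x \in image_submod gS by apply/asboolP; exists x.
have [a aE] := dP (Submod gxT).
have gxE : g (val x) = \sum_j a j *: g (val (s j)).
  rewrite -[LHS]/(val (Submod gxT)) aE val_lincomb.
  by under [RHS]eq_bigr do rewrite sE.
pose x' := \sum_j a j *: s j.
have /ex[y yE] : g (val x - val x') = 0.
  rewrite linearB gxE val_lincomb linear_sum -sumrB big1 // => j _.
  by rewrite [X in _ - X]linearZ_LR subrr.
have yU : y \in preim_submod f S.
  by rewrite mem_preimage yE; exact: (valP (x - x')).
have [b bE] := uP (Submod yU).
exists (fun i => match fintype.split i with inl j => a j | inr k => b k end).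
apply: val_inj; rewrite val_lincomb big_split_ord.
have -> : val x = val x' + f y by rewrite yE addrC subrK.
congr (_ + _).
  rewrite val_lincomb; apply: eq_bigr => j _.
  by rewrite (unsplitK (inl j)).
rewrite -[y]/(val (Submod yU)) bE val_lincomb linear_sum; apply: eq_bigr => k _.
by rewrite (unsplitK (inr k)) [LHS]linearZ_LR.
Qed.

Lemma noetherian_power n : noetherian R -> noetherian_module ('I_n -> R^o).
Proof.
move=> noethR; elim: n => [|n IH].
  move=> S; exists 0%N, (fun=> 0) => x; exists (fun=> 0).
  by apply: val_inj; apply: funext => -[].
pose f (r : R^o) : 'I_n.+1 -> R^o := fun i => if i == ord0 then r else 0.
have f_lin : linear f.
  move=> a x y; apply: funext => i; rewrite !fctE /f.
  by case: (i == ord0) => //; rewrite scaler0 addr0.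
pose g (h : 'I_n.+1 -> R^o) : 'I_n -> R^o := h \o lift ord0.
have g_lin : linear g by [].
apply: (noetherian_extension (f := to_linear f_lin) (g := to_linear g_lin)) => // h.
split=> [gh|[r <-]]; last by apply: funext.
exists (h ord0); apply: funext => i; rewrite /= /f.
case: (unliftP ord0 i) => [j ->|-> //].
exact: (esym (congr1 (fun k => k j) gh)).
Qed.

(** The relations between [n] generators form a submodule of [R^n], which is
noetherian; the rows of [k] are generators of that submodule. *)
Lemma noetherian_presentation M : noetherian R -> finitely_generated M ->
  exists n (e : 'I_n -> M) m (k : 'I_m -> 'I_n -> R),
    (forall x, exists a : 'I_n -> R, x = \sum_i a i *: e i) /\
    (forall a : 'I_n -> R, \sum_i a i *: e i = 0 <->
       exists b : 'I_m -> R, forall i, a i = \sum_j b j * k j i).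
Proof.
move=> noethR [n [e eP]].
pose p (a : 'I_n -> R^o) : M := \sum_i (a i : R) *: e i.
have p_lin : linear p.
  move=> c a b; rewrite /p scaler_sumr -big_split; apply: eq_bigr => i _.
  by rewrite scalerA; exact: scalerDl.
have [m [k kP]] := noetherian_power noethR (kernel_submod (to_linear p_lin)).
exists n, e, m, (fun j => val (k j)); split=> // a; split=> [a0|[b ab]].
  have aK : (a : 'I_n -> R^o) \in kernel_submod (to_linear p_lin).
    by rewrite mem_kernel; apply/eqP.
  have [b bE] := kP (Submod aK); exists b => i.
  by rewrite -[LHS]/(val (Submod aK) i) bE val_lincomb fct_sumE.
have k0 j : p (val (k j)) = 0 by case: (k j) => z /= /eqP.
transitivity (\sum_j b j *: p (val (k j))); last first.
  by rewrite big1 // => j _; rewrite k0 scaler0.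
under [RHS]eq_bigr do rewrite scaler_sumr.
rewrite exchange_big; apply: eq_bigr => i _; rewrite ab scaler_suml.
by apply: eq_bigr => j _; rewrite scalerA.
Qed.

Lemma hom_from_presentation M N n (e : 'I_n -> M) (d : 'I_n -> N) :
  (forall x, exists a : 'I_n -> R, x = \sum_i a i *: e i) ->
  (forall a : 'I_n -> R, \sum_i a i *: e i = 0 -> \sum_i a i *: d i = 0) ->
  exists h : {linear M -> N}, forall i, h (e i) = d i.
Proof.
move=> eP de.
have [c cE] : {c : M -> 'I_n -> R | forall x, x = \sum_i c x i *: e i}.
  by exists (fun x => sval (cid (eP x))) => x; exact: svalP (cid (eP x)).
have wd (a b : 'I_n -> R) : \sum_i a i *: e i = \sum_i b i *: e i ->
    \sum_i a i *: d i = \sum_i b i *: d i.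
  move/eqP; rewrite -subr_eq0 -sumrB; under eq_bigr do rewrite -scalerBl.
  move/eqP/(de (fun i => a i - b i)) => ab; apply/eqP; rewrite -subr_eq0 -sumrB.
  by under eq_bigr do rewrite -scalerBl; rewrite ab.
have h_lin : linear (fun x => \sum_i c x i *: d i).
  move=> a x y.
  rewrite scaler_sumr -big_split /=.
  under [RHS]eq_bigr do rewrite scalerA -scalerDl.
  apply: (wd _ (fun i => a * c x i + c y i)); rewrite -cE.
  under eq_bigr do rewrite scalerDl -scalerA.
  by rewrite big_split -scaler_sumr -!cE.
exists (to_linear h_lin) => i /=.
transitivity (\sum_j (j == i)%:R *: d j).
  apply: (wd _ (fun j => (j == i)%:R)); rewrite -cE (bigD1 i) //= eqxx scale1r.
  by rewrite big1 ?addr0 // => j /negPf ->; rewrite scale0r.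
rewrite (bigD1 i) //= eqxx scale1r.
by rewrite big1 ?addr0 // => j /negPf ->; rewrite scale0r.
Qed.

End Noetherian.

(** * Homomorphisms from C into F (x) C *)

Lemma linear_inverse (R : comPzRingType) (A B : lmodType R) (f : {linear A -> B}) :
  bijective f -> exists g : {linear B -> A}, cancel f g /\ cancel g f.
Proof.
case=> g fK gK.
have g_lin : linear g by move=> a x y; apply: (can_inj fK); rewrite linearP !gK.
by exists (to_linear g_lin).
Qed.

Section TensorPower.
Variables (R : comPzRingType) (n : nat).
Implicit Types M N : lmodType R.

Fact power_inj_linear M (i : 'I_n) :
  linear (fun (x : M) (j : 'I_n) => if j == i then x else 0).
Proof.
move=> a x y; apply: funext => j; rewrite !fctE.
by case: (j == i); rewrite ?scaler0 ?addr0.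
Qed.

Definition power_inj M (i : 'I_n) : {linear M -> ('I_n -> M)} :=
  to_linear (@power_inj_linear M i).

Definition power_proj M (i : 'I_n) : {linear ('I_n -> M) -> M} :=
  @to_linear R ('I_n -> M) M (fun c => c i) (fun a x y => erefl).

Lemma power_expansion M (c : 'I_n -> M) : c = \sum_i power_inj M i (power_proj M i c).
Proof.
apply: funext => j; rewrite fct_sumE (bigD1 j) //= eqxx big1 ?addr0 // => i ij.
by rewrite eq_sym (negPf ij).
Qed.

Lemma tensor_power_expansion M N (t : tensor N ('I_n -> M)) :
  t = \sum_i tensor_map idfun (power_inj M i) (tensor_map idfun (power_proj M i) t).
Proof.
elim/tensor_ind: t => [x c|t t' IH IH'].
  rewrite {1}(power_expansion c) -[LHS]/(tens_right_fun _ x _) linear_sum.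
  by apply: eq_bigr => i _; rewrite 2!tensor_mapE.
rewrite {1}IH {1}IH' -big_split; apply: eq_bigr => i _.
by rewrite !linearD.
Qed.

Lemma power_projK M (i j : 'I_n) (x : M) :
  power_proj M i (power_inj M j x) = if i == j then x else 0.
Proof. by []. Qed.
End TensorPower.

Section HomTensor.
Variables (R : comPzRingType) (C F : lmodType R).
Hypotheses (R_noetherian : noetherian R) (C_fg : finitely_generated C).
Hypothesis C_homothety : bijective (homothety C).
Hypothesis F_flat : flat F.

(** A finite presentation of [C] turns [R = Hom(C, C)] into an exact sequence
[0 -> R -> C^n -> C^m]: the first map evaluates a homothety at the generators,
the second one evaluates the relations. It stays exact after tensoring with the
flat module [F], and then describes [F] as [Hom(C, F (x) C)], because finite
powers commute with tensor products. *)
Lemma tens_right_bijective : bijective (tens_right F C).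
Proof.
have [n [e [m [k [eP kP]]]]] := noetherian_presentation R_noetherian C_fg.
pose al_fun (r : R^o) : 'I_n -> C := fun i => (r : R) *: e i.
have al_lin : linear al_fun.
  by move=> a r s; apply: funext => i; rewrite !fctE /al_fun scalerDl scalerA.
pose al : {linear R^o -> ('I_n -> C)} := to_linear al_lin.
pose be_fun (c : 'I_n -> C) : 'I_m -> C := fun j => \sum_i k j i *: c i.
have be_lin : linear be_fun.
  move=> a c d; apply: funext => j; rewrite !fctE /be_fun scaler_sumr -big_split.
  apply: eq_bigr => i _; rewrite -[LHS]/(k j i *: (a *: c i + d i)).
  by rewrite scalerDr !scalerA mulrC.
pose be : {linear ('I_n -> C) -> ('I_m -> C)} := to_linear be_lin.
have rel0 j : \sum_i k j i *: e i = 0.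
  apply/kP; exists (fun j' => (j' == j)%:R) => i.
  rewrite (bigD1 j) //= eqxx mul1r big1 ?addr0 // => j' /negPf ->.
  by rewrite mul0r.
have ex_albe : exact_at al be.
  move=> c; split=> [c0|[r <-]]; last first.
    apply: funext => j; rewrite /= /be_fun /al_fun.
    transitivity ((r : R) *: \sum_i k j i *: e i); last by rewrite rel0 scaler0.
    by rewrite scaler_sumr; apply: eq_bigr => i _; rewrite !scalerA mulrC.
  have [h he] : exists h : {linear C -> C}, forall i, h (e i) = c i.
    apply: (hom_from_presentation eP) => a /kP[b ab].
    transitivity (\sum_j b j *: be c j); last first.
      by rewrite big1 // => j _; rewrite c0 scaler0.
    under [RHS]eq_bigr do rewrite scaler_sumr.
    rewrite exchange_big; apply: eq_bigr => i _; rewrite ab scaler_suml.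
    by apply: eq_bigr => j _; rewrite scalerA.
  have [r rh] := bijective_surj h C_homothety.
  by exists r; apply: funext => i; rewrite -he -rh.
have ex_al : exact_at (0 : {linear R^o -> R^o}) al.
  move=> r; split=> [r0|[s <-]]; last exact: (linear0 al).
  exists 0; symmetry; apply: (bijective_ker0 C_homothety).
  apply: linear_ext => x; have [a ->] := eP x.
  apply: (etrans (linear_sum _ _ _ _)); apply: big1 => i _.
  rewrite [LHS]linearZ_LR; apply: etrans (congr1 _ (congr1 (fun c => c i) r0)) _.
  exact: scaler0.
have tens_one (w : tensor F R^o) : exists x, w = @tens R F R^o x 1.
  elim/tensor_ind: w => [x r|_ _ [x ->] [y ->]]; last by exists (x + y); rewrite tensDl.
  by exists ((r : R) *: x); rewrite tensZl -tensZr; congr tens; exact: (esym (mulr1 _)).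
have ida (x : F) : tensor_map idfun al (@tens R F R^o x 1) =
    \sum_i tensor_map idfun (power_inj C i) (tens x (e i)).
  rewrite [LHS]tensor_power_expansion; apply: eq_bigr => i _.
  congr (tensor_map _ _ _).
  by rewrite 2!tensor_mapE; exact: (congr1 (tens x) (scale1r (e i))).
apply: linear_bijective => [x x0|h].
  have /(F_flat ex_al)[w] : tensor_map (idfun : {linear F -> F}) al (@tens R F R^o x 1) = 0.
    rewrite ida big1 // => i _.
    have -> : tens x (e i) = 0 by exact: (congr1 (fun f : {linear C -> tensor F C} => f (e i)) x0).
    exact: linear0.
  rewrite tensor_map_eq0r // => /esym x1.
  pose u : {linear tensor F R^o -> F} := tensor_lift (homothety F) \o tensor_swap F R^o.
  have : u (@tens R F R^o x 1) = 0 by rewrite x1 linear0.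
  by rewrite linear_compE tensor_swapE tensor_liftE => <-; exact: (esym (scale1r x)).
(* [t] is the tuple of the values of [h] at the generators. *)
pose t := \sum_i tensor_map (idfun : {linear F -> F}) (power_inj C i) (h (e i)).
have proj_t i : tensor_map idfun (power_proj C i) t = h (e i).
  rewrite linear_sum (bigD1 i) // -[RHS]addr0; congr (_ + _).
    rewrite tensor_map_comp tensor_map_id // => x.
    by rewrite [LHS]power_projK eqxx.
  apply: big1 => j /negPf ji; rewrite tensor_map_comp tensor_map_eq0r // => x.
  by rewrite [LHS]power_projK eq_sym ji.
have /(F_flat ex_albe)[w] : tensor_map (idfun : {linear F -> F}) be t = 0.
  rewrite [LHS]tensor_power_expansion big1 // => j _.
  suff -> : tensor_map idfun (power_proj C j) (tensor_map idfun be t) = 0 by exact: linear0.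
  have -> : tensor_map idfun (power_proj C j) (tensor_map idfun be t) =
      \sum_i k j i *: tensor_map idfun (power_proj C i) t.
    elim/tensor_ind: {proj_t} t => [x c|t t' IH IH'].
      rewrite 2!tensor_mapE -[LHS]/(tens_right_fun _ x _) linear_sum.
      by apply: eq_bigr => i _; rewrite tensor_mapE -tensZr.
    rewrite !linearD IH IH' -big_split; apply: eq_bigr => i _.
    by rewrite linearD scalerDr.
  under eq_bigr do rewrite proj_t -linearZ_LR.
  by rewrite -linear_sum rel0 linear0.
have [x -> wt] := tens_one w; exists x.
have xe i : tens x (e i) = h (e i).
  rewrite -proj_t -wt 2!tensor_mapE; congr tens.
  exact: (esym (scale1r _)).
apply: linear_ext => c; have [a ->] := eP c.
rewrite !linear_sum; apply: eq_bigr => i _; rewrite !linearZ_LR.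
by congr (_ *: _); exact: xe.
Qed.

Variables (Q : lmodType R) (Q_iso : isomorphic Q (tensor F C)).

(** Transport of the previous lemma along [Q = F (x) C]: [Hom(C, Q)] is [F], and
evaluation becomes the symmetry [C (x) F = F (x) C]. *)
Lemma C_flat_evaluation : bijective (evaluation C Q) /\ flat {linear C -> Q}.
Proof.
have [be be_bij] := isomorphic_sym Q_iso.
have [al [alK beK]] := linear_inverse be_bij.
pose eta : {linear F -> {linear C -> Q}} := hom_post C be \o tens_right F C.
have post_bij : bijective (hom_post C be).
  by exists (hom_post C al) => h; apply: linear_ext => c; [exact: alK | exact: beK].
have [th [etaK thK]] := linear_inverse (bij_comp post_bij tens_right_bijective : bijective eta).
split; last exact: flat_retract thK F_flat.
have evE w : evaluation C Q (tensor_map idfun eta (tensor_swap F C w)) = be w.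
  apply: (@tensor_ext _ _ _ _
    (evaluation C Q \o (tensor_map idfun eta \o tensor_swap F C)) be) => x c.
  by rewrite 2!linear_compE tensor_swapE tensor_mapE [LHS]tensor_liftE.
have surj z : exists w, tensor_map idfun eta (tensor_swap F C w) = z.
  exists (tensor_swap C F (tensor_map idfun th z)).
  by rewrite tensor_swapK tensor_map_comp tensor_map_id.
apply: linear_bijective => [z|q].
  have [w <-] := surj z; rewrite evE => /(bijective_ker0 be_bij) ->.
  by rewrite !linear0.
by exists (tensor_map idfun eta (tensor_swap F C (al q))); rewrite evE beK.
Qed.

End HomTensor.

(** * Augmented resolutions and Tor *)

Section Complexes.
Variable R : comPzRingType.
Implicit Types M N H : lmodType R.

Definition exact_complex (X : complex R) : Prop :=
  forall n, exact_at (diff X n) (diff_out X n).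

Lemma acyclic_exact (X : complex R) : acyclic X -> exact_complex X.
Proof.
move=> X_acyclic n b; split=> [gb|[a <-]]; last exact: diff_outK.
exact: (homology_is_zero _ _).1 (X_acyclic n) b gb.
Qed.

Lemma free_res_diff_exact M n : exact_at (free_res_diff M n) (free_cover (syzygy M n)).
Proof.
move=> b; split=> [gb|[a <-]].
  have bK : b \in kernel_submod (free_cover (syzygy M n)) by rewrite mem_kernel; apply/eqP.
  have [a aE] := @free_cover_surj _ (syzygy M n.+1) (Submod bK).
  by exists a; apply: (congr1 val aE).
apply/eqP; rewrite -mem_kernel; exact: valP (free_cover (syzygy M n.+1) a).
Qed.

Lemma free_res_augK M x : free_cover M (diff (free_res M) 0 x) = 0.
Proof. exact: (exact_at_comp0 (@free_res_diff_exact M 0) x). Qed.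

Definition aug_free_res M : complex R := augmented (@free_res_augK M).

Lemma aug_free_res_exact M : exact_complex (aug_free_res M).
Proof.
case=> [|[|n]] b.
- by split=> // _; exact: free_cover_surj.
- exact: (@free_res_diff_exact M 0 b).
- split=> [gb|[a <-]]; last exact: free_res_diffK.
  by apply: (@free_res_diff_exact M n.+1 b).1; apply: val_inj; exact: gb.
Qed.

Lemma aug_free_res_flat M n : flat (aug_free_res M n.+1).
Proof. exact: free_flat. Qed.

Lemma augmented_surj (X : complex R) M (aug : {linear X 0%N -> M})
    (augK : forall x, aug (diff X 0 x) = 0) :
  exact_complex (augmented augK) -> forall x, exists y, aug y = x.
Proof. by move=> ex x; apply/(ex 0%N x). Qed.

(** In degrees 0 and 1 right exactness does the work; above, the homology is
that of the complex without its augmentation, shifted by one. *)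
Lemma tensor_augmented_exact (X : complex R) M (aug : {linear X 0%N -> M})
    (augK : forall x, aug (diff X 0 x) = 0) N :
  exact_complex (augmented augK) ->
  (forall i, (1 <= i)%N -> is_zero (homology (tensor_complex X N) i)) ->
  forall n, is_zero (middle_homology
    (tensor_map (diff (augmented augK) n) (idfun : {linear N -> N}))
    (tensor_map (diff_out (augmented augK) n) (idfun : {linear N -> N}))).
Proof.
move=> ex tor0 [|[|n]].
- apply/homology_is_zero => b _; apply: tensor_surj => x; last by exists x.
  exact: augmented_surj ex x.
- apply/homology_is_zero => b.
  exact: (@tensor_right_exact _ _ _ _ N _ _ (ex 1%N) (augmented_surj ex) b).1.
- exact: (tor0 n.+1).
Qed.

(** The edges of the double complex of the free resolution of [C] and of [Y] are
that resolution tensored with [Y_0], whose homology is Tor(C, Y_0), and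
[C (x) Y]. Tor being defined by resolving its first variable, this is how its
vanishing acts on resolutions of the second one. *)
Lemma Tor_vanishing_flip C (Y : complex R) :
  (forall i, (1 <= i)%N -> is_zero (Tor i C (Y 0))) ->
  exact_complex Y -> (forall q, flat (Y q.+1)) ->
  forall q, exact_at (tensor_map (idfun : {linear C -> C}) (diff Y q))
                     (tensor_map (idfun : {linear C -> C}) (diff_out Y q)).
Proof.
move=> tor0 exY flatY q b; split=> [gb|[a <-]]; last first.
  by rewrite tensor_map_comp tensor_map_eq0r // => x; exact: diff_outK.
have exC : exact_complex (aug_free_res C) := @aug_free_res_exact C.
have flatC p : flat (aug_free_res C p.+1) := @aug_free_res_flat C p.
have [f f_bij] := tensor_balance
  (fun p q => flat_right (flatY q) (exC p)) (fun p q => flatC p _ _ _ _ _ (exY q)) q.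
apply: ((homology_is_zero _ _).1 _ b gb) => y.
have [x <-] := bijective_surj y f_bij.
by rewrite (tensor_augmented_exact exC tor0 x) linear0.
Qed.

(** Both sides are [M (x) N]; comparing images there avoids naming the
isomorphisms. *)
Lemma homology0_tensor (X X' : complex R) M (aug : {linear X 0%N -> M})
    (aug' : {linear X' 0%N -> M}) (augK : forall x, aug (diff X 0 x) = 0)
    (augK' : forall x, aug' (diff X' 0 x) = 0) N :
  exact_complex (augmented augK) -> exact_complex (augmented augK') ->
  isomorphic (homology (tensor_complex X N) 0) (homology (tensor_complex X' N) 0).
Proof.
move=> ex ex'; set id_N := idfun : {linear N -> N}.
have surj := tensor_surj (augmented_surj ex) (fun y : N => ex_intro (fun x => id_N x = y) y erefl).
have surj' := tensor_surj (augmented_surj ex') (fun y : N => ex_intro (fun x => id_N x = y) y erefl).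
have rex := @tensor_right_exact _ _ _ _ N _ _ (ex 1%N) (augmented_surj ex).
have rex' := @tensor_right_exact _ _ _ _ N _ _ (ex' 1%N) (augmented_surj ex').
apply: (isomorphic_homology (rel := fun x x' =>
  tensor_map aug id_N x = tensor_map aug' id_N x')).
- by move=> a x y x' y' xx' yy'; rewrite !linearP xx' yy'.
- by move=> x _; have [x' xx'] := surj' (tensor_map aug id_N x); exists x'.
- by move=> x' _; have [x xx'] := surj (tensor_map aug' id_N x'); exists x.
- move=> x x' xx'.
  by split=> [/rex h|/rex' h]; [apply/rex' | apply/rex]; rewrite -?h ?xx' // -xx'.
Qed.

(** By balance, the homology of [X (x) N] is that of [M (x) L] in positive degrees,
[L] being the augmented free resolution of [N]; the same holds for the free
resolution of [M] in place of [X], which defines Tor(M, N). *)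
Theorem Tor_acyclic_resolution (X : complex R) M (aug : {linear X 0%N -> M})
    (augK : forall x, aug (diff X 0 x) = 0) N i :
  exact_complex (augmented augK) ->
  (forall p q, exact_at
     (tensor_map (idfun : {linear X p -> X p}) (diff (aug_free_res N) q))
     (tensor_map (idfun : {linear X p -> X p}) (diff_out (aug_free_res N) q))) ->
  isomorphic (homology (tensor_complex X N) i) (Tor i M N).
Proof.
move=> exX acX; case: i => [|i].
  exact: homology0_tensor exX (@aug_free_res_exact M).
have exM : exact_complex (aug_free_res M) := @aug_free_res_exact M.
have exN : exact_complex (aug_free_res N) := @aug_free_res_exact N.
have flatM p : flat (aug_free_res M p.+1) := @aug_free_res_flat M p.
have flatN q : flat (aug_free_res N q.+1) := @aug_free_res_flat N q.
(* The augmentation sits in degree 0, whence the shift of the degree. *)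
have isoX := tensor_balance (X := augmented augK)
  (fun p q => flat_right (flatN q) (exX p)) acX i.+2.
have isoM := tensor_balance
  (fun p q => flat_right (flatN q) (exM p)) (fun p q => flatM p _ _ _ _ _ (exN q)) i.+2.
exact: isomorphic_trans isoX (isomorphic_sym isoM).
Qed.

Lemma evaluation_natural C M N (f : {linear M -> N}) z :
  evaluation C N (tensor_map idfun (hom_post C f) z) = f (evaluation C M z).
Proof.
apply: (@tensor_ext _ _ _ _ (evaluation C N \o tensor_map idfun (hom_post C f))
  (f \o evaluation C M)) => c h.
rewrite 2!linear_compE tensor_mapE [LHS]tensor_liftE; congr (f _).
by rewrite [RHS]tensor_liftE.
Qed.

(** Where evaluation is bijective it identifies [C (x) Hom(C, X)] with
[X] as complexes, by naturality. *)
Lemma exact_of_tensor_hom_exact C (X : complex R) :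
  (forall n, bijective (evaluation C (X n))) ->
  (forall n, exact_at
     (tensor_map (idfun : {linear C -> C}) (diff (hom_to_complex C X) n))
     (tensor_map (idfun : {linear C -> C}) (diff_out (hom_to_complex C X) n))) ->
  exact_complex X.
Proof.
move=> ev_bij ex n b; split=> [gb|[a <-]]; last exact: diff_outK.
have [z zb] := bijective_surj b (ev_bij n).
have /ex[a az] : tensor_map idfun (diff_out (hom_to_complex C X) n) z = 0.
  case: n b gb z zb => [|n] b gb z zb; first exact: tensor_map_eq0r.
  by apply: (bijective_ker0 (ev_bij n)); rewrite [LHS]evaluation_natural zb.
by exists (evaluation C _ a); rewrite -evaluation_natural [X in evaluation _ _ X]az.
Qed.

End Complexes.

Lemma C_projective_flat (R : comPzRingType) (C X : lmodType R) :
  C_projective C X -> C_flat C X.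
Proof. by case=> P /projective_flat flatP XP; exists P. Qed.

(** The two classes of the theorem are treated at once: all that matters is that
the class contains [C] and consists of modules [F (x) C] with [F] flat. *)
Theorem relative_Tor_iso (R : comPzRingType) (C M N : lmodType R)
    (cls : lmodType R -> Prop) (Q : proper_resolution cls M) i :
  noetherian R -> semidualizing C -> bass C M -> auslander C N ->
  cls C -> (forall X, cls X -> C_flat C X) ->
  isomorphic (relative_Tor Q i N) (Tor i M N).
Proof.
move=> noethR [C_fg C_hom _] [_ torM evM] [torN _ _] clsC cls_flat.
pose Y := hom_to_complex C (augmented (@res_augK _ _ _ Q)).
have Q_ev p : bijective (evaluation C (Q p)) /\ flat {linear C -> Q p}.
  have [F flatF QF] := cls_flat _ (res_cls Q p).
  exact: C_flat_evaluation noethR C_fg C_hom flatF _ QF.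
have exCY := Tor_vanishing_flip (Y := Y) torM (acyclic_exact (@res_proper _ _ _ Q C clsC))
  (fun q => (Q_ev q).2).
have exQ : exact_complex (augmented (@res_augK _ _ _ Q)).
  by apply: exact_of_tensor_hom_exact exCY => -[|n] //; exact: (Q_ev n).1.
apply: (@Tor_acyclic_resolution _ Q M _ (@res_augK _ _ _ Q) N i exQ) => p q.
(* [C (x) L] is exact for the free resolution [L] of [N], hence so is
   [F (x) C (x) L]. *)
have exCN := Tor_vanishing_flip (Y := aug_free_res N) torN (@aug_free_res_exact R N)
  (@aug_free_res_flat R N).
have [F flatF [f f_bij]] := cls_flat _ (res_cls Q p).
have [g [fK gK]] := linear_inverse f_bij.
have gf0 x : diff_out (aug_free_res N) q (diff (aug_free_res N) q x) = 0 by exact: diff_outK.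
apply: (exact_at_retract (u := tensor_map g idfun) (i := tensor_map f idfun)
  (r := tensor_map g idfun) (v := tensor_map f idfun) _ _ _ _
  (flat_tensor_exact flatF gf0 (@exCN q))).
- by move=> z; rewrite tensor_map_comp tensor_map_id.
- by move=> z; rewrite !tensor_map_comp; exact: eq_tensor_map.
- by move=> z; rewrite !tensor_map_comp; exact: eq_tensor_map.
- by move=> z; rewrite tensor_map_comp; exact: tensor_map_eq0r.
Qed.

Theorem proposition4p3 (R : comPzRingType) (C M N : lmodType R)
    (R_noetherian : noetherian R) (C_semidualizing : semidualizing C)
    (M_bass : bass C M) (N_auslander : auslander C N) :
  (forall (Q : proper_resolution (C_projective C) M) (i : nat),
      isomorphic (relative_Tor Q i N) (Tor i M N)) /\
  (forall (G : proper_resolution (C_flat C) M) (i : nat),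
      isomorphic (relative_Tor G i N) (Tor i M N)).
Proof.
have C_proj : C_projective C C.
  exists R^o; first exact: regular_projective.
  exact: isomorphic_sym (regular_tensor C).
by split=> Q i; apply: (@relative_Tor_iso _ C) => //; exact: C_projective_flat.
Qed.
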